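(* The kernels of the semigroups generated by the operators $\mathcal L$ and $\tilde{\mathcal L}$, which determine the transitional probability density and the Laplace transform, are related to the kernels of the semigroups generated by the Schr\''odinger operators $\mathbb H_1$ and $\mathbb H_2$ as follows: $$e^{(T-t)\mathcal L}(x,y)=\frac{h(y)}{h(x)}\left(\frac{A(x)^2}{R(x)}\right)^{1/4}\left(\frac{R(y)}{A(y)^2}\right)^{3/4}e^{-(T-t)\mathbb H_1}\big(Z(x),Z(y)\big),$$ $$e^{(T-t)\tilde{\mathcal L}}(x,y)=\frac{h(y)}{h(x)}\left(\frac{A(x)^2}{R(x)}\right)^{1/4}\left(\frac{R(y)}{A(y)^2}\right)^{3/4}e^{-(T-t)\mathbb H_2}\big(Z(x),Z(y)\big).$$
   Context: Setting. $A(x),Q(x,\vartheta),R(x),S(x)$ are polynomials of degree at most $2$ in $x$, with $A(x)\in\{1,x,x(1-x),x^2+1\}$ and $R\ge0$; $h$ is a (strictly positive) solution on the domain $D_x\subset\mathbb R$ of $\frac{A^2}{R}h''+\frac{S}{R}h=\xi h$ for some $\xi\in\mathbb R$. The diffusion $X_t$ on $D_x$ solves $$dX_t=2\frac{h'(X_t)}{h(X_t)}\frac{A(X_t)^2}{R(X_t)}dt+\frac{\sqrt2A(X_t)}{\sqrt{R(X_t)}}dW_t$$ with given reflection/absorption conditions at the boundary of $D_x$, and $\phi(x)=\frac{Q(x,\vartheta)}{\vartheta R(x)}$. Its generator and Feynman-Kac operator are $$\mathcal L=\frac{A(x)^2}{R(x)}\frac{\partial^2}{\partial x^2}+2\frac{h'(x)}{h(x)}\frac{A(x)^2}{R(x)}\frac{\partial}{\partial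 x},\qquad\tilde{\mathcal L}=\mathcal L-\vartheta\phi(x).$$ The transitional probability density is $p_{T-t}(x,y)=e^{(T-t)\mathcal L}(x,y)$, and the Laplace transform $L_{T-t}(x,\vartheta)=E[e^{-\vartheta\int_t^T\phi(X_s)ds}q(X_T)\mid X_t=x]$ equals $\int_{D_x}q(y)e^{(T-t)\tilde{\mathcal L}}(x,y)dy$, where $e^{\tau\mathcal O}(x,y)$ denotes the integral kernel (with respect to Lebesgue measure in $y$) of the semigroup generated by $\mathcal O$. $Z:D_x\to D_z$ is a diffeomorphism with $Z'(x)=\frac{\sqrt{R(x)}}{A(x)}$ and inverse $X$, and $g(z)=\left(\frac{A(X(z))^2}{R(X(z))}\right)^{1/4}$. The Schr\''odinger operators on $D_z$ are $\mathbb H_i=-\frac{\partial^2}{\partial z^2}+U_i(z)$, $i=1,2$, with $$U_1(z)=\Big(\frac{g'}{g}\Big)^2-\Big(\frac{g'}{g}\Big)'-\frac{S(X(z))}{R(X(z))}+\xi,\qquad U_2(z)=\Big(\frac{g'}{g}\Big)^2-\Big(\frac{g'}{g}\Big)'-\frac{S(X(z))-Q(X(z),\vartheta)}{R(X(z))}+\xi,$$ where $'$ on $g$ denotes the derivative in $z$; the boundary conditions on $D_z$ are those transported from $D_x$. *)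

(* Defs.v *)
From HB Require Import structures.
From mathcomp Require Import all_boot all_order all_algebra.
From mathcomp Require Import all_classical all_reals all_analysis.

Set Implicit Arguments.
Unset Strict Implicit.
Unset Printing Implicit Defensive.

Import Order.TTheory GRing.Theory Num.Theory.
Import numFieldNormedType.Exports.

Local Open Scope classical_set_scope.
Local Open Scope ring_scope.

(* Functions on an open interval D are total functions R -> R of which only the
   values on D are ever used; all derivatives are taken at points of D. *)

Definition C2_on (R : realType) (D : set R) (f : R -> R) : Prop :=
  forall x, D x ->
    [/\ derivable f x 1, derivable (derive1 f) x 1 &
        {for x, continuous (derive1 (derive1 f))}].

Definition diffeomorphism (R : realType) (D E : set R) (Z X : R -> R) : Prop :=
  [/\ forall x, D x -> E (Z x) /\ X (Z x) = x,
      forall z, E z -> D (X z) /\ Z (X z) = z,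
      forall x, D x -> derivable Z x 1 /\ {for x, continuous (derive1 Z)} &
      forall z, E z -> derivable X z 1 /\ {for z, continuous (derive1 X)}].

(* The Hilbert space L^2(D, w(x) dx), with its squared norm. *)

Definition sqnorm (R : realType) (D : set R) (w f : R -> R) : \bar R :=
  (\int[@lebesgue_measure R]_(x in D) (w x * f x ^+ 2)%:E)%E.

Definition L2 (R : realType) (D : set R) (w f : R -> R) : Prop :=
  measurable_fun D f /\ (sqnorm D w f < +oo)%E.

Definition sqdist (R : realType) (D : set R) (w f k : R -> R) : \bar R :=
  sqnorm D w (fun x => f x - k x).

(* The graph of the closure in L^2(D, w dx) of the differential operator O,
   initially defined on the C^2 functions f such that f and O f are in L^2 and
   such that f satisfies the boundary conditions B. *)

Definition operator_core (R : realType) (D : set R) (w : R -> R)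
    (O : (R -> R) -> (R -> R)) (B : (R -> R) -> Prop) (f : R -> R) : Prop :=
  [/\ C2_on D f, L2 D w f, L2 D w (O f) & B f].

Definition closure_graph (R : realType) (D : set R) (w : R -> R)
    (O : (R -> R) -> (R -> R)) (B : (R -> R) -> Prop) (f F : R -> R) : Prop :=
  forall e : R, 0 < e -> exists u : R -> R,
    [/\ operator_core D w O B u,
        (sqdist D w u f < e%:E)%E & (sqdist D w (O u) F < e%:E)%E].

(* Integral operator with kernel k with respect to Lebesgue measure. *)
Definition kernel_op (R : realType) (D : set R) (k : R -> R -> R) (f : R -> R) :
    R -> R :=
  fun x => (\int[@lebesgue_measure R]_(y in D) (k x y * f y))%R.

(* K t x y (t > 0, x, y in D) is the integral kernel, with respect to dy, of the
   strongly continuous semigroup on L^2(D, w dx) generated by (the closure of) O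
   with boundary conditions B.  The clauses are: continuity of the kernel in
   (x, y), which selects the pointwise defined version; existence of the
   integrals; exponential boundedness; semigroup law; strong continuity at 0;
   the infinitesimal generator is the closure of O. *)
Definition semigroup_kernel (R : realType) (D : set R) (w : R -> R)
    (O : (R -> R) -> (R -> R)) (B : (R -> R) -> Prop)
    (K : R -> R -> R -> R) : Prop :=
  [/\ forall t x y, 0 < t -> D x -> D y ->
        {for (x, y), continuous (fun p : R * R => K t p.1 p.2)},
      forall t f x, 0 < t -> L2 D w f -> D x ->
        (@lebesgue_measure R).-integrable D (fun y => (K t x y * f y)%:E),
      (exists M omega : R, forall t f, 0 < t -> L2 D w f ->
         L2 D w (kernel_op D (K t) f) /\
         (sqnorm D w (kernel_op D (K t) f)
            <= ((M * expR (omega * t)) ^+ 2)%:E * sqnorm D w f)%E),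
      forall s t f, 0 < s -> 0 < t -> L2 D w f ->
        sqdist D w (kernel_op D (K (s + t)) f)
          (kernel_op D (K s) (kernel_op D (K t) f)) = 0%E &
      (forall f, L2 D w f ->
         sqdist D w (kernel_op D (K t) f) f @[t --> 0^'+] --> 0%E) /\
      (forall f F, L2 D w f -> L2 D w F ->
         (sqdist D w (fun x => t^-1 * (kernel_op D (K t) f x - f x)) F
            @[t --> 0^'+] --> 0%E)
         <-> closure_graph D w O B f F)].

(* Boundary behaviour of the diffusion at an end of D, which may be infinite;
   Free is for ends at which no condition is imposed (inaccessible ends). *)
Inductive boundary_behaviour := Absorbing | Reflecting | Free.

Definition vanishes_at_left_end (R : realType) (D : set R) (u : R -> R) : Prop :=
  forall e : R, 0 < e ->
    exists2 c, D c & forall x, D x -> x < c -> `|u x| < e.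

Definition vanishes_at_right_end (R : realType) (D : set R) (u : R -> R) : Prop :=
  forall e : R, 0 < e ->
    exists2 c, D c & forall x, D x -> c < x -> `|u x| < e.

(* The scale density of the diffusion with drift 2 (h'/h) A^2/P and squared
   volatility 2 A^2/P is h^-2, so h^2 f' is the derivative of f with respect to
   the scale function: this is what vanishes at a reflecting end. *)
Definition end_condition (R : realType) (vanishes : (R -> R) -> Prop)
    (h : R -> R) (b : boundary_behaviour) (f : R -> R) : Prop :=
  match b with
  | Absorbing => vanishes f
  | Reflecting => vanishes (fun x => h x ^+ 2 * derive1 f x)
  | Free => True
  end.

Definition boundary_conditions (R : realType) (D : set R) (h : R -> R)
    (bl br : boundary_behaviour) (f : R -> R) : Prop :=
  end_condition (vanishes_at_left_end D) h bl f /\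
  end_condition (vanishes_at_right_end D) h br f.

Section Operators.
Variables (R : realType) (A P S : {poly R}) (h : R -> R).
(* P is the polynomial called R in the diffusion; here R is the field of reals. *)

Definition generator (f : R -> R) : R -> R := fun x =>
  A.[x] ^+ 2 / P.[x] * derive1 (derive1 f) x
  + 2 * (derive1 h x / h x) * (A.[x] ^+ 2 / P.[x]) * derive1 f x.

Definition rate (Q : R -> {poly R}) (theta x : R) : R :=
  (Q theta).[x] / (theta * P.[x]).

Definition feynman_kac (Q : R -> {poly R}) (theta : R) (f : R -> R) : R -> R :=
  fun x => generator f x - theta * rate Q theta x * f x.

(* Density of the speed measure, with respect to which both operators above
   are formally symmetric. *)
Definition speed_density (x : R) : R := h x ^+ 2 * (P.[x] / A.[x] ^+ 2).

Variable X : R -> R.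

Definition gauge (z : R) : R := (A.[X z] ^+ 2 / P.[X z]) `^ (1 / 4).

Definition log_gauge' (z : R) : R := derive1 gauge z / gauge z.

Definition potential1 (xi z : R) : R :=
  log_gauge' z ^+ 2 - derive1 log_gauge' z - S.[X z] / P.[X z] + xi.

Definition potential2 (Q : R -> {poly R}) (theta xi z : R) : R :=
  log_gauge' z ^+ 2 - derive1 log_gauge' z
  - (S.[X z] - (Q theta).[X z]) / P.[X z] + xi.

Definition schrodinger (U psi : R -> R) : R -> R :=
  fun z => - derive1 (derive1 psi) z + U z * psi z.

(* A function psi on the z-side corresponds to (gauge \o Z) / h * (psi \o Z)
   on the x-side. *)
Definition transported_conditions (Z : R -> R) (B : (R -> R) -> Prop)
    (psi : R -> R) : Prop :=
  B (fun x => gauge (Z x) / h x * psi (Z x)).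

End Operators.

(* Main.v *)
Require Import Defs.
From HB Require Import structures.
From mathcomp Require Import all_boot all_order all_algebra.
From mathcomp Require Import all_classical all_reals all_analysis.
From mathcomp Require Import measurable_realfun ring lra.

Set Implicit Arguments.
Unset Strict Implicit.
Unset Printing Implicit Defensive.

Import Order.TTheory GRing.Theory Num.Theory.
Import numFieldNormedType.Exports.

Local Open Scope classical_set_scope.
Local Open Scope ring_scope.

(** Write a = A^2/P for half of the squared volatility, G = a^(1/4) (the gauge
    read on the x-side) and c = G/h.  The map V psi = c (psi o Z) is a unitary
    from L^2(D_z, dz) onto L^2(D_x, w dx), w = h^2/a the speed density, because
    w c^2 = a^(-1/2) = |Z'|.  It intertwines - H_i with the generator, resp.
    the Feynman-Kac operator: the first-order terms cancel since G^2 Z' is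
    constant, and what is left of G'' and h'' is exactly the potential, by the
    equation satisfied by h (liouville_intertwine).  Boundary conditions on D_z
    are by definition those carried by V.  Conjugating by V the semigroup with
    kernel e^{-t H_i}(z, z') therefore gives a semigroup on L^2(D_x, w dx)
    with kernel c(x) e^{-t H_i}(Z x, Z y) |Z' y| / c(y), which is the right-hand
    side of the announced formula, and with the same generator as the
    diffusion semigroup (semigroup_kernel_transport).

    Two strongly continuous semigroups T and S with the same generator agree on
    its domain: s |-> T(t-s) S(s) f has right derivative zero
    (semigroup_unique).  The domain contains the C^2 bumps supported in a
    compact subinterval of D_x; testing two kernels, continuous in (x, y),
    against a bump concentrated near a point where they would differ shows
    that they are equal everywhere (semigroup_kernel_le).

    That V is unitary is the change of variables formula for a C^1
    diffeomorphism and arbitrary measurable integrands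
    (ge0_integral_diffeomorphism).  It is obtained from the fundamental theorem
    of calculus on segments, since these determine a measure. *)

(** * Uniqueness of the semigroup with a given generator *)

(** A left lower semicontinuous function with nonpositive upper right derivative
    does not increase: for each slope e > 0 the set of s up to which
    phi <= phi 0 + e s holds is closed by the second hypothesis, and it can be
    extended to the right by the first. *)
Lemma right_dini_le (R : realType) (phi : R -> R) (t : R) : 0 <= t ->
  (forall s e : R, 0 <= s < t -> 0 < e -> exists2 d, 0 < d &
     forall r : R, 0 < r < d -> s + r <= t -> phi (s + r) <= phi s + e * r) ->
  (forall s e : R, 0 < s <= t -> 0 < e -> exists2 d, 0 < d &
     forall r : R, 0 < r < d -> r <= s -> phi s <= phi (s - r) + e) ->
  phi t <= phi 0.
Proof.
move=> t0 hr hl; apply/ler_addgt0Pr => e0 e0_gt0.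
pose e := e0 / (t + 1).
have e_gt0 : 0 < e by rewrite divr_gt0// ltr_wpDl.
pose E := [set s : R | 0 <= s <= t /\
  forall s' : R, 0 <= s' <= s -> phi s' <= phi 0 + e * s'].
have E0 : E 0.
  split=> [|s' /andP[s'0 s'1]]; first by rewrite lexx.
  have -> : s' = 0 by apply/le_anti; rewrite s'0 s'1.
  by rewrite mulr0 addr0.
have Eub : ubound E t by move=> s [/andP[]].
have hsE : has_sup E by split; [exists 0|exists t].
pose m := sup E.
have m0 : 0 <= m by apply: ub_le_sup E0; exists t.
have mt : m <= t by apply: ge_sup => //; exists 0.
have below (s : R) : 0 <= s < m -> phi s <= phi 0 + e * s.
  move=> /andP[s0 sm].
  have [u [_ hu] su] := sup_gt (ex_intro _ 0 E0) sm.
  by apply: hu; rewrite s0 ltW.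
have atm : phi m <= phi 0 + e * m.
  have [->|m_gt0] := eqVneq m 0; first by rewrite mulr0 addr0.
  have {}m_gt0 : 0 < m by rewrite lt_neqAle eq_sym m_gt0.
  apply/ler_addgt0Pr => e' e'0.
  have [|d d0 hd] := hl m e' _ e'0; first by rewrite m_gt0.
  pose r := Num.min (d / 2) m.
  have r0 : 0 < r by rewrite lt_min m_gt0 divr_gt0.
  have rm : r <= m by rewrite ge_min lexx orbT.
  have rd : r < d by rewrite gt_min; apply/orP; left; lra.
  have := hd r; rewrite r0 rd => /(_ isT rm) /le_trans; apply.
  rewrite lerD2r; apply: (le_trans (below _ _)).
    by rewrite subr_ge0 rm ltrBlDr ltrDl.
  by rewrite lerD2l ler_pM2l// gerBl ltW.
have Em : E m.
  split=> [|s /andP[s0]]; first by rewrite m0.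
  by rewrite le_eqVlt => /predU1P[->//|sm]; apply: below; rewrite s0.
have mE : m = t.
  apply/le_anti; rewrite mt leNgt; apply/negP => mlt.
  have [|d d0 hd] := hr m e _ e_gt0; first by rewrite m0.
  pose r := Num.min (d / 2) (t - m).
  have r0 : 0 < r by rewrite lt_min subr_gt0 mlt divr_gt0.
  have rd : r < d by rewrite gt_min; apply/orP; left; lra.
  have rt : m + r <= t by rewrite -lerBrDl ge_min lexx orbT.
  suff : E (m + r).
    by move=> /(ub_le_sup (ex_intro _ t Eub)); rewrite -/m gerDl leNgt r0.
  split=> [|s /andP[s0 smr]]; first by rewrite rt addr_ge0 // ltW.
  have [sm|ms] := leP s m; first by apply: Em.2; rewrite s0.
  pose r' := s - m.
  have sE : s = m + r' by rewrite /r' addrC subrK.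
  have r'0 : 0 < r' < d.
    by rewrite /r' subr_gt0 ms/=; apply: le_lt_trans rd; rewrite lerBlDl.
  have := hd r' r'0; rewrite -sE => /(_ (le_trans smr rt))/le_trans; apply.
  by clearbody r'; rewrite sE mulrDr addrA lerD2r.
rewrite -mE; apply: (le_trans atm); rewrite lerD2l mE /e -mulrA ler_piMr ?(ltW e0_gt0)//.
by rewrite mulrC ler_pdivrMr ?mul1r ?lerDl// ltr_wpDl.
Qed.

Section SemigroupUniqueness.
Context {R : realType} {V : lmodType R}.

(** L plays the role of L^2, as a set of functions defined everywhere, and N
    that of its norm, which does not separate almost everywhere equal functions:
    equalities of vectors are stated as N (f - g) = 0. *)
Record seminormed_subspace (L : V -> Prop) (N : V -> R) : Prop := {
  subspaceB : forall f g, L f -> L g -> L (f - g) ;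
  subspaceZ : forall c f, L f -> L (c *: f) ;
  seminorm_ge0 : forall f, 0 <= N f ;
  seminormB : forall f g, L f -> L g -> N (f - g) <= N f + N g ;
  seminormZ : forall c f, L f -> N (c *: f) = `|c| * N f }.

(** G is the graph of the infinitesimal generator, and T 0 is the identity, so
    that orbits are defined on closed time intervals. *)
Record strongly_continuous_semigroup (L : V -> Prop) (N : V -> R)
    (G : V -> V -> Prop) (T : R -> V -> V) : Prop := {
  semigroup0 : forall f, T 0 f = f ;
  semigroup_bounded : forall t0, exists2 C, 0 <= C & forall t f,
    0 <= t <= t0 -> L f -> L (T t f) /\ N (T t f) <= C * N f ;
  semigroupD : forall s t f, 0 <= s -> 0 <= t -> L f ->
    N (T (s + t) f - T s (T t f)) = 0 ;
  semigroup_linear : forall t c f g, 0 <= t -> L f -> L g ->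
    N (T t (f - c *: g) - (T t f - c *: T t g)) = 0 ;
  semigroup_continuous : forall f e, L f -> 0 < e ->
    exists2 d, 0 < d & forall t, 0 < t < d -> N (T t f - f) <= e ;
  semigroup_generator : forall f F, L f -> L F ->
    (G f F <-> forall e, 0 < e ->
      exists2 d, 0 < d & forall t, 0 < t < d -> N (T t f - f - t *: F) <= e * t) }.

Variables (L : V -> Prop) (N : V -> R).
Hypothesis LN : seminormed_subspace L N.

Let LB f g : L f -> L g -> L (f - g). Proof. exact: (subspaceB LN). Qed.
Let LZ c f : L f -> L (c *: f). Proof. exact: (subspaceZ LN). Qed.

Let N0 f : L f -> N (f - f) = 0.
Proof.
by move=> Lf; rewrite subrr -(scale0r f) (seminormZ LN)// normr0 mul0r.
Qed.

Let NC f g : L f -> L g -> N (f - g) = N (g - f).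
Proof.
move=> Lf Lg; have -> : f - g = (- 1) *: (g - f) by rewrite scaleN1r opprB.
by rewrite (seminormZ LN) ?normrN1 ?mul1r//; exact: LB.
Qed.

Let Ntri g f h : L f -> L g -> L h -> N (f - h) <= N (f - g) + N (g - h).
Proof.
move=> Lf Lg Lh; have -> : f - h = (f - g) - (h - g) by rewrite opprB addrA subrK.
by rewrite (NC Lg Lh); apply: (seminormB LN); exact: LB.
Qed.

Lemma semigroup_stable G T t f : strongly_continuous_semigroup L N G T -> 0 <= t -> L f -> L (T t f).
Proof.
move=> hT t0 Lf; have [C _ /(_ t f)] := semigroup_bounded hT t.
by rewrite t0 lexx => /(_ isT Lf)[].
Qed.

Lemma semigroup_lipschitz G T t0 : strongly_continuous_semigroup L N G T ->
  exists2 C, 0 < C & forall t f g, 0 <= t <= t0 -> L f -> L g ->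
    N (T t f - T t g) <= C * N (f - g).
Proof.
move=> hT; have [C C0 hC] := semigroup_bounded hT t0.
exists (C + 1); first by rewrite ltr_wpDl.
move=> t f g t0t Lf Lg.
have t_ge0 : 0 <= t by case/andP: t0t.
have Lfg : L (f - g) by exact: LB.
have LTf := semigroup_stable hT t_ge0 Lf; have LTg := semigroup_stable hT t_ge0 Lg.
have := semigroup_linear hT 1 t_ge0 Lf Lg; rewrite !scale1r => hlin.
have LT := semigroup_stable hT t_ge0 Lfg.
have -> : T t f - T t g = T t (f - g) - (T t (f - g) - (T t f - T t g)).
  by rewrite opprB addrCA subrr addr0.
apply: (le_trans (seminormB LN LT (LB LT (LB LTf LTg)))).
rewrite hlin addr0; apply: le_trans (hC t _ t0t Lfg).2 _.
by rewrite ler_wpM2r ?(seminorm_ge0 LN)// lerDl.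
Qed.

(** Since T r (T s f) and T s (T r f) agree up to a null vector, the difference quotient of T s f is
    the image under T s of that of f, and T s is bounded. *)
Lemma generator_orbit G T s f F : strongly_continuous_semigroup L N G T ->
  0 <= s -> L f -> L F -> G f F -> G (T s f) (T s F).
Proof.
move=> hT s0 Lf LF /(semigroup_generator hT Lf LF) hf.
have LTf := semigroup_stable hT s0 Lf; have LTF := semigroup_stable hT s0 LF.
apply/(semigroup_generator hT) => // e e0.
have [C C0 hC] := semigroup_lipschitz s hT.
have [|d d0 hd] := hf (e / C); first by rewrite divr_gt0.
exists d => // r /[dup] rd /andP[/ltW r0 _].
have LTrf := semigroup_stable hT r0 Lf.
set a := T r (T s f).
have La : L a by exact: (semigroup_stable hT).
set b := T s (T r f).
have Lb : L b by exact: (semigroup_stable hT).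
have ab : N (a - b) = 0.
  apply/le_anti; rewrite (seminorm_ge0 LN) andbT.
  have Lc : L (T (r + s) f) by apply: (semigroup_stable hT) => //; exact: addr_ge0.
  apply: (le_trans (Ntri La Lc Lb)).
  by rewrite (NC La)// (semigroupD hT)// addrC addr0 (addrC r) (semigroupD hT).
pose k := f - (- r) *: F.
have Lk : L k by apply: LB => //; exact: LZ.
have LTk : L (T s k) by exact: (semigroup_stable hT).
have hk : N (T s k - (T s f - (- r) *: T s F)) = 0 by exact: (semigroup_linear hT).
have Lm : L (T s f - (- r) *: T s F) by apply: LB => //; exact: LZ.
have -> : a - T s f - r *: T s F = a - (T s f - (- r) *: T s F).
  by rewrite scaleNr opprK opprD addrA.
apply: (le_trans (Ntri La Lb Lm)); rewrite ab add0r.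
apply: (le_trans (Ntri Lb LTk Lm)); rewrite hk addr0.
have ss : 0 <= s <= s by rewrite s0 lexx.
apply: (le_trans (hC s _ _ ss LTrf Lk)).
have -> : T r f - k = T r f - f - r *: F by rewrite /k scaleNr opprK opprD addrA.
by rewrite mulrC -ler_pdivlMr// mulrAC; exact: hd.
Qed.

(** The path u s = T (t - s) (S s f) joins T t f to S t f.  With g = S s f, which
    stays in the domain, u (s + r) - u s is up to a null vector
    T (t - s - r) (S r g - T r g), and S r g - T r g is o(r) because both
    semigroups have the same derivative at g.  So the right derivative of
    N (u s - u 0) is at most 0. *)
Theorem semigroup_unique G T S t f F :
  strongly_continuous_semigroup L N G T ->
  strongly_continuous_semigroup L N G S ->
  0 <= t -> L f -> L F -> G f F -> N (S t f - T t f) = 0.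
Proof.
move=> hT hS t0 Lf LF GfF.
have [C C0 hC] := semigroup_lipschitz t hT.
have [C' C'0 hC'] := semigroup_lipschitz t hS.
pose u s := T (t - s) (S s f).
have LS s : 0 <= s -> L (S s f) by move=> ?; exact: (semigroup_stable hS).
have Lu s : 0 <= s <= t -> L (u s).
  by move=> /andP[s0 st]; apply: (semigroup_stable hT); rewrite ?subr_ge0//; exact: LS.
have step s r : 0 <= s -> 0 <= r -> s + r <= t ->
    N (u (s + r) - u s) <= C * N (S (s + r) f - T r (S s f)).
  move=> s0 r0 srt; have sr0 : 0 <= s + r by exact: addr_ge0.
  have st : s <= t by apply: le_trans srt; rewrite lerDl.
  have q0 : 0 <= t - (s + r) by rewrite subr_ge0.
  have LTr : L (T r (S s f)) by apply: (semigroup_stable hT) => //; exact: LS.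
  have LTT : L (T (t - (s + r)) (T r (S s f))) by exact: (semigroup_stable hT).
  have L1 : L (u (s + r)) by apply: Lu; rewrite sr0.
  have L2 : L (u s) by apply: Lu; rewrite s0.
  apply: (le_trans (Ntri L1 LTT L2)).
  have -> : N (T (t - (s + r)) (T r (S s f)) - u s) = 0.
    rewrite NC// /u; have -> : t - s = t - (s + r) + r by lra.
    by apply: (semigroupD hT) => //; exact: LS.
  rewrite addr0; apply: hC => //; last exact: LS.
  by rewrite q0 gerBl.
pose phi s := N (u s - u 0).
have L0 : L (u 0) by apply: Lu; rewrite lexx.
have phi_le s s' : 0 <= s <= t -> 0 <= s' <= t ->
    phi s' <= phi s + N (u s' - u s).
  move=> hs hs'; rewrite addrC; exact: Ntri (Lu _ hs') (Lu _ hs) L0.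
suff : phi t <= phi 0.
  rewrite /phi (N0 L0) /u !subrr subr0 (semigroup0 hT) (semigroup0 hS) => h.
  by apply/le_anti; rewrite h (seminorm_ge0 LN).
apply: right_dini_le => // s e.
- move=> /andP[s0 st] e0.
  have Lg := LS _ s0; set g := S s f in Lg *.
  have LF' : L (S s F) by exact: (semigroup_stable hS).
  have GgF : G g (S s F) by exact: (generator_orbit hS).
  (* The generators of S and T each contribute one such error, which the bound C
     of T multiplies. *)
  have e'0 : 0 < e / (C * 2) by rewrite divr_gt0// mulr_gt0.
  have [d d0 hd] := (semigroup_generator hS Lg LF').1 GgF _ e'0.
  have [d' d'0 hd'] := (semigroup_generator hT Lg LF').1 GgF _ e'0.
  exists (Num.min d d'); first by rewrite lt_min d0.
  move=> r /andP[r0]; rewrite lt_min => /andP[rd rd'] srt.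
  have hs : 0 <= s <= t by rewrite s0 ltW.
  have hs' : 0 <= s + r <= t by rewrite srt andbT addr_ge0// ltW.
  apply: (le_trans (phi_le _ _ hs hs')); rewrite lerD2l.
  apply: (le_trans (step _ _ s0 (ltW r0) srt)).
  have LSr : L (S r g) by apply: (semigroup_stable hS) => //; exact: ltW.
  have LTr : L (T r g) by apply: (semigroup_stable hT) => //; exact: ltW.
  have Lsr : L (S (s + r) f) by apply: LS; case/andP: hs'.
  have h1 : N (S (s + r) f - T r g) <= N (S r g - T r g).
    apply: (le_trans (Ntri Lsr LSr LTr)).
    by rewrite [s + r]addrC (semigroupD hS (ltW r0) s0 Lf) add0r.
  have Lm : L (g + r *: S s F).
    by rewrite -[r *: _]opprK -scaleNr; apply: LB => //; exact: LZ.
  have h2 : N (S r g - T r g) <= e / (C * 2) * r + e / (C * 2) * r.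
    apply: (le_trans (Ntri LSr Lm LTr)); apply: lerD.
      by rewrite opprD addrA; apply: hd; rewrite r0.
    by rewrite NC// opprD addrA; apply: hd'; rewrite r0.
  have -> : e * r = C * (e / (C * 2) * r + e / (C * 2) * r).
    by field; rewrite gt_eqF.
  by rewrite ler_pM2l//; exact: le_trans h2.
- move=> /andP[s0 st] e0.
  have Lg := LS _ (ltW s0); set g := S s f in Lg *.
  (* From the left, g is approximated by T r g, and T r g by T r (S (s - r) f)
     since S r f tends to f. *)
  have e'0 : 0 < e / (C * 2) by rewrite divr_gt0// mulr_gt0.
  have [d d0 hd] := semigroup_continuous hT Lg e'0.
  have e''0 : 0 < e / (C * 2) / (C * C') by rewrite divr_gt0// mulr_gt0.
  have [d' d'0 hd'] := semigroup_continuous hS Lf e''0.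
  exists (Num.min d d'); first by rewrite lt_min d0.
  move=> r /andP[r0]; rewrite lt_min => /andP[rd rd'] rs.
  have sr0 : 0 <= s - r by rewrite subr_ge0.
  have srt : s - r <= t by apply: le_trans st; rewrite gerBl ltW.
  have hs : 0 <= s <= t by rewrite st ltW.
  have hs' : 0 <= s - r <= t by rewrite sr0.
  apply: (le_trans (phi_le _ _ hs' hs)); rewrite lerD2l.
  have := step _ _ sr0 (ltW r0); rewrite subrK => /(_ st)/le_trans; apply.
  have Lg' := LS _ sr0; set g' := S (s - r) f in Lg' *.
  rewrite -/g.
  have rr : 0 <= r <= t by rewrite (ltW r0) (le_trans rs).
  have LTg : L (T r g) by apply: (semigroup_stable hT) => //; exact: ltW.
  have LTg' : L (T r g') by apply: (semigroup_stable hT) => //; exact: ltW.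
  have LSS : L (S (s - r) (S r f)).
    by apply: (semigroup_stable hS) => //; apply: LS; exact: ltW.
  have h1 : N (g - g') <= C' * N (S r f - f).
    apply: (le_trans (Ntri Lg LSS Lg')).
    have := semigroupD hS sr0 (ltW r0) Lf; rewrite subrK -/g => ->.
    by rewrite add0r; apply: hC' => //; apply: LS; exact: ltW.
  have h2 : N (S r f - f) <= e / (C * 2) / (C * C') by apply: hd'; rewrite r0.
  have h3 : N (g - T r g) <= e / (C * 2) by rewrite NC//; apply: hd; rewrite r0.
  have h4 : N (T r g - T r g') <= C * N (g - g') by exact: hC.
  have h5 := Ntri Lg LTg LTg'.
  have -> : e = C * (e / (C * 2) + C * (C' * (e / (C * 2) / (C * C')))).
    by field; rewrite !gt_eqF.
  rewrite ler_pM2l//; apply: (le_trans h5); apply: lerD => //.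
  apply: (le_trans h4); rewrite ler_pM2l//.
  by apply: (le_trans h1); rewrite ler_pM2l.
Qed.

End SemigroupUniqueness.

(** * The weighted space of square integrable functions *)

Section RightLimits.
Context {R : realType}.

Lemma near_at_right0P (P : R -> Prop) :
  (\forall t \near 0^'+, P t) <->
  exists2 d : R, 0 < d & forall t, 0 < t < d -> P t.
Proof.
rewrite near_withinE near_nbhs; split.
  move=> /nbhs_ballP[d /= d0 hd]; exists d => // t /andP[t0 td].
  by apply: hd => //=; rewrite /ball/= sub0r normrN gtr0_norm.
move=> [d d0 hd]; apply/nbhs_ballP; exists d => //= t /= td t0.
by apply: hd; rewrite t0/=; move: td; rewrite /ball/= sub0r normrN gtr0_norm.
Qed.

Lemma ge0_cvge_at_right0P (F : R -> \bar R) : (forall t, 0 <= F t)%E ->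
  F t @[t --> 0^'+] --> 0%E <->
  forall e : R, 0 < e ->
    exists2 d, 0 < d & forall t, 0 < t < d -> (F t <= e%:E)%E.
Proof.
move=> F0; split.
  move=> /fine_cvgP[fin /cvgrPdist_le cv] e e0; apply/near_at_right0P.
  near=> t.
  have ft : F t \is a fin_num by near: t.
  have : `|0 - (fine \o F) t| <= e by near: t; exact: cv.
  rewrite sub0r normrN /= ger0_norm ?fine_ge0// => h.
  by rewrite -(fineK ft) lee_fin.
move=> h; apply/fine_cvgP; split.
  have /near_at_right0P := h 1 ltr01; apply: filterS => t Ft.
  by rewrite ge0_fin_numE// (le_lt_trans Ft)// ltry.
apply/cvgrPdist_le => e e0; have /near_at_right0P := h e e0.
apply: filterS => t Ft; rewrite sub0r normrN /= ger0_norm ?fine_ge0//.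
have ft : F t \is a fin_num by rewrite ge0_fin_numE// (le_lt_trans Ft)// ltry.
by rewrite -lee_fin fineK.
Unshelve. all: by end_near. Qed.

End RightLimits.

Section WeightedL2.
Context {R : realType}.
Variables (D : set R) (w : R -> R).
Hypotheses (mD : measurable D) (mw : measurable_fun D w)
  (w0 : forall x, D x -> 0 <= w x).
Local Notation mu := (@lebesgue_measure R).
Implicit Types f g : R -> R.

Lemma sqnorm_ge0 f : (0 <= sqnorm D w f)%E.
Proof.
by apply: integral_ge0 => x Dx; rewrite lee_fin mulr_ge0 ?w0// sqr_ge0.
Qed.

Lemma eq_sqnorm f g : (forall x, D x -> f x = g x) -> sqnorm D w f = sqnorm D w g.
Proof. by move=> fg; apply: eq_integral => x /[!inE] Dx; rewrite fg. Qed.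

Lemma measurable_sqnorm (f : R -> R) : measurable_fun D f ->
  measurable_fun D (fun x => (w x * f x ^+ 2)%:E).
Proof.
by move=> mf; apply/measurable_EFinP/measurable_funM => //; exact: measurable_funX.
Qed.

Lemma sqnormZ c (f : R -> R) : measurable_fun D f ->
  sqnorm D w (fun x => c * f x) = ((c ^+ 2)%:E * sqnorm D w f)%E.
Proof.
move=> mf; rewrite /sqnorm -ge0_integralZl_EFin//; last 3 first.
- by move=> x Dx; rewrite lee_fin mulr_ge0 ?w0// sqr_ge0.
- exact: measurable_sqnorm.
- exact: sqr_ge0.
by apply: eq_integral => x _; rewrite -EFinM; congr EFin; ring.
Qed.

(** Minkowski's inequality, from the pointwise bound
    (f + g)^2 <= (1 + b/a) f^2 + (1 + a/b) g^2. *)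
Lemma sqnormD (f g : R -> R) a b : 0 < a -> 0 < b ->
  measurable_fun D f -> measurable_fun D g ->
  (sqnorm D w f <= (a ^+ 2)%:E)%E -> (sqnorm D w g <= (b ^+ 2)%:E)%E ->
  (sqnorm D w (fun x => f x + g x)%R <= ((a + b) ^+ 2)%:E)%E.
Proof.
move=> a0 b0 mf mg hf hg.
have ba0 : 0 <= 1 + b / a by rewrite addr_ge0// divr_ge0// ltW.
have ab0 : 0 <= 1 + a / b by rewrite addr_ge0// divr_ge0// ltW.
have pos k x : D x -> (0 <= (w x * k x ^+ 2)%:E)%E.
  by move=> Dx; rewrite lee_fin mulr_ge0 ?w0// sqr_ge0.
apply: (@le_trans _ _ ((1 + b / a)%:E * sqnorm D w f + (1 + a / b)%:E * sqnorm D w g)%E).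
  rewrite /sqnorm -!ge0_integralZl_EFin//; try exact: measurable_sqnorm; try exact: pos.
  rewrite -ge0_integralD//; last 4 first.
  - by move=> x Dx; rewrite mule_ge0// pos.
  - by apply: measurable_funeM; exact: measurable_sqnorm.
  - by move=> x Dx; rewrite mule_ge0// pos.
  - by apply: measurable_funeM; exact: measurable_sqnorm.
  apply: ge0_le_integral => //.
  - exact: pos.
  - by apply: measurable_sqnorm; exact: measurable_funD.
  - by apply: emeasurable_funD; apply: measurable_funeM; exact: measurable_sqnorm.
  move=> x Dx; rewrite -!EFinM -EFinD lee_fin.
  have -> : (1 + b / a) * (w x * f x ^+ 2) + (1 + a / b) * (w x * g x ^+ 2)
      = w x * ((1 + b / a) * f x ^+ 2 + (1 + a / b) * g x ^+ 2) by ring.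
  apply: ler_wpM2l; first exact: w0.
  rewrite -subr_ge0.
  have -> : (1 + b / a) * f x ^+ 2 + (1 + a / b) * g x ^+ 2 - (f x + g x) ^+ 2
      = (b * f x - a * g x) ^+ 2 / (a * b) by field; rewrite !gt_eqF.
  by rewrite divr_ge0 ?sqr_ge0// mulr_ge0// ltW.
have -> : ((a + b) ^+ 2)%:E = ((1 + b / a)%:E * (a ^+ 2)%:E +
    (1 + a / b)%:E * (b ^+ 2)%:E)%E :> \bar R.
  by rewrite -!EFinM -EFinD; congr EFin; field; rewrite !gt_eqF.
by apply: leeD; apply: lee_pmul => //; rewrite ?lee_fin// sqnorm_ge0.
Qed.

Definition L2norm (f : R -> R^o) : R := Num.sqrt (fine (sqnorm D w f)).

Lemma L2norm_ge0 f : 0 <= L2norm f. Proof. exact: sqrtr_ge0. Qed.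

Lemma sqr_L2norm f : L2 D w f -> sqnorm D w f = (L2norm f ^+ 2)%:E.
Proof.
move=> [_ hf]; rewrite /L2norm sqr_sqrtr ?fine_ge0 ?sqnorm_ge0// fineK//.
by rewrite ge0_fin_numE// sqnorm_ge0.
Qed.

Lemma L2norm_le f e : 0 <= e -> (sqnorm D w f <= (e ^+ 2)%:E)%E -> L2norm f <= e.
Proof.
move=> e0 h; rewrite -(ger0_norm e0) -sqrtr_sqr ler_wsqrtr//.
rewrite -lee_fin fineK// ge0_fin_numE ?sqnorm_ge0//.
by apply: le_lt_trans h _; rewrite ltry.
Qed.

Lemma eq_L2 f g : (forall x, D x -> f x = g x) -> L2 D w f -> L2 D w g.
Proof.
move=> fg [mf hf]; split; last by rewrite -(eq_sqnorm fg).
by apply: eq_measurable_fun mf => x /[!inE]; exact: fg.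
Qed.

Lemma L2Z c f : L2 D w f -> L2 D w (fun x => c * f x).
Proof.
move=> hf; have [mf _] := hf; split; first exact: measurable_funM.
by rewrite sqnormZ// sqr_L2norm// -EFinM ltry.
Qed.

(** The slack e makes both bounds given to sqnormD positive. *)
Lemma L2D_le f g e : 0 < e -> L2 D w f -> L2 D w g ->
  (sqnorm D w (fun x => f x + g x)%R <= ((L2norm f + L2norm g + e) ^+ 2)%:E)%E.
Proof.
move=> e0 hf hg.
have -> : L2norm f + L2norm g + e = (L2norm f + e / 2) + (L2norm g + e / 2) by field.
have e20 : 0 < e / 2 by rewrite divr_gt0.
apply: sqnormD; first by rewrite ltr_wpDl// L2norm_ge0.
- by rewrite ltr_wpDl// L2norm_ge0.
- by case: hf.
- by case: hg.
- by rewrite sqr_L2norm// lee_fin lerXn2r ?nnegrE ?addr_ge0 ?L2norm_ge0 ?(ltW e20)// lerDl ltW.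
- by rewrite sqr_L2norm// lee_fin lerXn2r ?nnegrE ?addr_ge0 ?L2norm_ge0 ?(ltW e20)// lerDl ltW.
Qed.

Lemma L2D f g : L2 D w f -> L2 D w g -> L2 D w (fun x => f x + g x).
Proof.
move=> hf hg; split; first by apply: measurable_funD; [case: hf|case: hg].
by apply: (le_lt_trans (L2D_le ltr01 hf hg)); rewrite ltry.
Qed.

Lemma L2normD f g : L2 D w f -> L2 D w g ->
  L2norm (fun x => f x + g x) <= L2norm f + L2norm g.
Proof.
move=> hf hg; apply/ler_addgt0Pr => e e0; apply: L2norm_le.
  by rewrite !addr_ge0 ?L2norm_ge0// ltW.
exact: L2D_le.
Qed.

Lemma L2normZ c f : L2 D w f -> L2norm (fun x => c * f x) = `|c| * L2norm f.
Proof.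
move=> hf; have [mf _] := hf; rewrite {1}/L2norm sqnormZ// sqr_L2norm// -EFinM /=.
by rewrite sqrtrM ?sqr_ge0// !sqrtr_sqr (ger0_norm (L2norm_ge0 _)).
Qed.

Lemma L2_seminormed : seminormed_subspace (V := R -> R^o) (L2 D w) L2norm.
Proof.
have LN f : L2 D w f -> L2 D w (fun x => (- 1) * f x) by exact: L2Z.
have subE (f g : R -> R^o) : f - g = (fun x => f x + (-1) * g x).
  by apply/funext => x; rewrite mulN1r.
split.
- by move=> f g hf hg; rewrite subE; apply: L2D => //; exact: LN.
- by move=> c f; exact: L2Z.
- exact: L2norm_ge0.
- move=> f g hf hg; rewrite subE; apply: (le_trans (L2normD hf (LN _ hg))).
  by rewrite L2normZ// normrN1 mul1r.
- by move=> c f; exact: L2normZ.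
Qed.

End WeightedL2.

(** * A continuous kernel is determined by its generator *)

Section KernelUniqueness.
Context {R : realType}.
Variables (D : set R) (w : R -> R).
Hypotheses (mD : measurable D) (mw : measurable_fun D w)
  (w0 : forall x, D x -> 0 <= w x).
Local Notation mu := (@lebesgue_measure R).

(** The kernel only describes positive times; this is its extension by the
    identity. *)
Definition kernel_semigroup (K : R -> R -> R -> R) (t : R) (f : R -> R^o) : R -> R^o :=
  if 0 < t then kernel_op D (K t) f else f.

Lemma kernel_op_linear (k : R -> R -> R) c (f g : R -> R) x :
  mu.-integrable D (fun y => (k x y * f y)%:E) ->
  mu.-integrable D (fun y => (k x y * g y)%:E) ->
  kernel_op D k (fun y => f y - c * g y) x =
  kernel_op D k f x - c * kernel_op D k g x.
Proof.
move=> hf hg; rewrite /kernel_op -RintegralZl// -RintegralB//; last first.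
  rewrite (_ : EFin \o _ = (fun y => c%:E * (k x y * g y)%:E)%E)//.
  exact: integrableZl.
by apply: eq_Rintegral => y _; ring.
Qed.

Lemma semigroup_of_kernel O B K : semigroup_kernel D w O B K ->
  strongly_continuous_semigroup (V := R -> R^o) (L2 D w) (L2norm D w)
    (closure_graph D w O B) (kernel_semigroup K).
Proof.
move=> [_ hint [M [om hM]] hD [hcont hgen]].
have N0 := L2norm_ge0 D w; have LN := L2_seminormed mD mw w0.
have LB f g : L2 D w f -> L2 D w g -> L2 D w (fun x => f x - g x).
  exact: (subspaceB LN).
have LZ c f : L2 D w f -> L2 D w (fun x => c * f x) by exact: (subspaceZ LN).
have LK t f : 0 < t -> L2 D w f -> L2 D w (kernel_op D (K t) f).
  by move=> t0 hf; have [] := hM t f t0 hf.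
have NN f g : sqdist D w f g = 0%E -> L2norm D w (fun x => f x - g x) = 0.
  by move=> h; rewrite /L2norm -/(sqdist D w f g) h /= sqrtr0.
have nil (f g : R -> R) : (forall x, D x -> f x = g x) ->
    L2norm D w (fun x => f x - g x) = 0.
  move=> fg; apply: NN; apply: integral0_eq => x Dx.
  by rewrite fg// subrr expr0n mulr0.
split.
- by move=> f; rewrite /kernel_semigroup ltxx.
- move=> t0; exists (1 + `|M| * expR (`|om| * `|t0|)).
    by rewrite addr_ge0// mulr_ge0// expR_ge0.
  move=> t f /andP[t_ge0 tt0] hf; rewrite /kernel_semigroup; case: ifPn => [t_gt0|_].
    split; first exact: LK.
    have C0 : 0 <= 1 + `|M| * expR (`|om| * `|t0|).
      by rewrite addr_ge0// mulr_ge0// expR_ge0.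
    apply: (L2norm_le w0); first by rewrite mulr_ge0.
    apply: (le_trans (hM t f t_gt0 hf).2).
    rewrite (sqr_L2norm w0)// -EFinM lee_fin -exprMn.
    rewrite -[leLHS]real_normK ?num_real// lerXn2r ?nnegrE ?mulr_ge0//.
    rewrite normrM (ger0_norm (N0 f)) ler_wpM2r//.
    rewrite normrM (ger0_norm (expR_ge0 _)) ler_wpDl// ler_wpM2l// ler_expR.
    apply: (le_trans (ler_norm _)); rewrite normrM ler_wpM2l//.
    by rewrite !ger0_norm// (le_trans t_ge0).
  by split=> //; rewrite mulrDl mul1r lerDl mulr_ge0// mulr_ge0// expR_ge0.
- move=> s t f; rewrite !le_eqVlt => /predU1P[<- |s0] /predU1P[<- |t0] hf;
    rewrite /kernel_semigroup ?addr0 ?add0r ?ltxx ?t0 ?s0 ?addr_gt0//;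
    try exact: nil.
  by apply: NN; exact: hD.
- move=> t c f g t0 hf hg; rewrite /kernel_semigroup; case: ifPn => [t_gt0|_].
    by apply: nil => x Dx; exact: kernel_op_linear (hint _ _ _ _ _ _) (hint _ _ _ _ _ _).
  exact: nil.
- move=> f e hf e0.
  have /ge0_cvge_at_right0P hc := hcont f hf.
  have [|d d0 hd] := hc _ (e ^+ 2) (exprn_gt0 _ e0).
    by move=> t; exact: sqnorm_ge0.
  exists d => // t td; have /andP[t0 _] := td.
  by rewrite /kernel_semigroup t0; apply: (L2norm_le w0) (hd t td); exact: ltW.
- move=> f F hf hF; rewrite -hgen// ge0_cvge_at_right0P; last first.
    by move=> t; exact: sqnorm_ge0.
  have key t : 0 < t ->
      L2 D w (fun x => kernel_op D (K t) f x - f x - t * F x) /\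
      sqdist D w (fun x => t^-1 * (kernel_op D (K t) f x - f x)) F =
      ((t^-1 * L2norm D w (fun x => kernel_op D (K t) f x - f x - t * F x)) ^+ 2)%:E.
    move=> t0; have hh : L2 D w (fun x => kernel_op D (K t) f x - f x - t * F x).
      by apply: (LB); [apply: (LB) => //; exact: LK|exact: LZ].
    split => //; rewrite /sqdist.
    rewrite (@eq_sqnorm _ D w _
      (fun x => t^-1 * (kernel_op D (K t) f x - f x - t * F x))); last first.
      by move=> x _; field; rewrite gt_eqF.
    rewrite sqr_L2norm//; last exact: LZ.
    rewrite (L2normZ mD mw w0 _ hh) ger0_norm// invr_ge0 ltW//.
  split=> h e e0.
    have [d d0 hd] := h (e ^+ 2) (exprn_gt0 _ e0).
    exists d => // t td; have /andP[t0 _] := td.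
    have := hd t td; have [_ ->] := key t t0.
    rewrite lee_fin ler_pXn2r// ?nnegrE ?(ltW e0)//; last first.
      by rewrite mulr_ge0// invr_ge0 ltW.
    by rewrite /kernel_semigroup t0 mulrC ler_pdivrMr.
  have [d d0 hd] := h (Num.sqrt e) (ltac:(by rewrite sqrtr_gt0)).
  exists d => // t td; have /andP[t0 _] := td.
  have := hd t td; have [_ ->] := key t t0.
  rewrite /kernel_semigroup t0 => hN.
  rewrite lee_fin -[leRHS]sqr_sqrtr ?(ltW e0)// ler_pXn2r// ?nnegrE ?sqrtr_ge0//.
    by rewrite mulrC ler_pdivrMr.
  by rewrite mulr_ge0// invr_ge0 ltW.
Qed.

Lemma integral_eq0_exists (k : R -> R) a b : measurable_fun D k ->
  (forall x, D x -> 0 <= k x) -> (\int[mu]_(x in D) (k x)%:E = 0)%E ->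
  a < b -> (forall x, a < x < b -> D x) -> exists2 x, a < x < b & k x = 0.
Proof.
move=> mk k0 ik ab abD.
have : ae_eq mu D (EFin \o k) (cst 0%E).
  apply/(ae_eq_integral_abs mu mD); first exact/measurable_EFinP.
  rewrite -[RHS]ik; apply: eq_integral => x /[!inE] Dx /=.
  by rewrite ger0_norm// k0.
move=> [N [mN N0 hN]]; apply: contrapT => h.
have sub : `]a, b[%classic `<=` N.
  move=> x; rewrite /= in_itv/= => xab; apply: hN => /= hx; apply: h.
  exists x => //; have := hx (abD _ xab); by move=> [].
have : (mu `]a, b[%classic <= 0)%E.
  by rewrite -N0; apply: le_measure; rewrite ?inE//; exact: measurable_itv.
by rewrite lebesgue_measure_itv/= lte_fin ab -EFinD lee_fin subr_le0 leNgt ab.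
Qed.

(** If K2 < K1 at a point, then K2 < K1 on a box around it.  Test against a core
    function f >= 0 supported in the second side of the box: both semigroups
    send f to the same class, so the two images coincide at some u in the first
    side, and the nonnegative function (K1 - K2)(u, .) f, of integral zero,
    vanishes at some point where f > 0. *)
Theorem semigroup_kernel_le O B K1 K2 t x y : open D ->
  (forall x, D x -> 0 < w x) ->
  (forall a b, a < b -> (forall x, a <= x <= b -> D x) ->
    exists f, [/\ operator_core D w O B f, forall x, D x -> 0 <= f x,
      forall x, a < x < b -> 0 < f x & forall x, ~ (a < x < b) -> f x = 0]) ->
  semigroup_kernel D w O B K1 -> semigroup_kernel D w O B K2 ->
  0 < t -> D x -> D y -> K1 t x y <= K2 t x y.
Proof.
move=> oD wpos bumps sK1 sK2 t0 Dx Dy; rewrite leNgt; apply/negP => K21.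
pose d (p : R * R) := K1 t p.1 p.2 - K2 t p.1 p.2.
have cd : {for (x, y), continuous d}.
  by apply: cvgB; [case: sK1 => + _ _ _ _|case: sK2 => + _ _ _ _]; exact.
have d0 : 0 < d (x, y) by rewrite subr_gt0.
have near_d : \forall p \near (x, y), 0 < d p by exact: (cvgr_gt (d (x, y)) cd).
have near_x : \forall p \near (x, y), D p.1.
  by apply: (@cvg_fst _ _ (nbhs x) (nbhs y)); exact: open_nbhs_nbhs.
have near_y : \forall p \near (x, y), D p.2.
  by apply: (@cvg_snd _ _ (nbhs x) (nbhs y)); exact: open_nbhs_nbhs.
have : \forall p \near (x, y), [/\ 0 < d p, D p.1 & D p.2].
  by near=> p; split; near: p.
move=> /nbhs_ballP[e /= e0 he].
have {}he u v : x - e < u < x + e -> y - e < v < y + e ->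
    [/\ 0 < d (u, v), D u & D v].
  move=> hu hv; apply: (he (u, v)); split => /=.
    by rewrite /ball/= distrC ltr_distl.
  by rewrite /ball/= distrC ltr_distl.
pose e2 := e / 2; have e20 : 0 < e2 by rewrite divr_gt0.
have ee : e2 < e by rewrite /e2; lra.
have [||f [coref f0 fpos fz]] := bumps (y - e2) (y + e2).
- by lra.
- move=> v hv; have [] := he x v => //; first by lra.
  by move: hv => /andP[? ?]; lra.
have [_ Lf LOf _] := coref.
have cf : closure_graph D w O B f (O f).
  have z g : sqdist D w g g = 0%E.
    by apply: integral0_eq => u _; rewrite subrr expr0n mulr0.
  by move=> r r0; exists f; split => //; rewrite z.
have sg1 := semigroup_of_kernel sK1; have sg2 := semigroup_of_kernel sK2.
have := semigroup_unique (L2_seminormed mD mw w0) sg1 sg2 (ltW t0) Lf LOf cf.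
rewrite /kernel_semigroup t0 => N0.
have [LK1 LK2] : L2 D w (kernel_op D (K1 t) f) /\ L2 D w (kernel_op D (K2 t) f).
  by case: sK1 => _ _ [? [? /(_ t f t0 Lf)[]]]; case: sK2 => _ _ [? [? /(_ t f t0 Lf)[]]].
have Ldiff : L2 D w (fun u => kernel_op D (K2 t) f u - kernel_op D (K1 t) f u).
  exact: (subspaceB (L2_seminormed mD mw w0) LK2 LK1).
have sq0 := sqr_L2norm w0 Ldiff; rewrite N0 expr0n/= in sq0.
have [||||u /andP[? ?]] := @integral_eq0_exists _ (x - e2) (x + e2) _ _ sq0.
- by apply: measurable_funM => //; apply: measurable_funX; case: Ldiff.
- by move=> u Du; rewrite mulr_ge0 ?sqr_ge0 ?w0.
- by lra.
- move=> u /andP[? ?]; have [] := he u y => //; lra.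
have [] := he u y; [lra|lra|] => _ Du _.
move=> /eqP; rewrite mulf_eq0 gt_eqF ?wpos//= sqrf_eq0 subr_eq0 eq_sym -subr_eq0 => /eqP.
have i1 := let: And5 _ h _ _ _ := sK1 in h t f u t0 Lf Du.
have i2 := let: And5 _ h _ _ _ := sK2 in h t f u t0 Lf Du.
have dfE v : d (u, v) * f v = K1 t u v * f v - K2 t u v * f v by rewrite /d/=; ring.
rewrite -RintegralB// => int0.
have i12 : mu.-integrable D (EFin \o (fun v => d (u, v) * f v)).
  rewrite (_ : EFin \o _ =
    (fun v => (K1 t u v * f v)%R%:E) \- (fun v => (K2 t u v * f v)%R%:E))%E.
    exact: integrableB.
  by apply/funext => v /=; rewrite dfE EFinB.
have [|||||v /andP[? ?]] := @integral_eq0_exists (fun v => d (u, v) * f v) (y - e2) (y + e2).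
- by apply/measurable_EFinP; exact: measurable_int i12.
- move=> v Dv; have [|hv] := EM (y - e2 < v < y + e2); last by rewrite fz ?mulr0.
  move=> /andP[? ?]; rewrite mulr_ge0 ?f0//.
  by have [||/ltW + _ _] := he u v; [lra|lra|].
- rewrite -[LHS]fineK; last exact: integrable_fin_num.
  by congr EFin; rewrite -int0; congr fine; apply: eq_integral => v _; rewrite dfE.
- by lra.
- by move=> v /andP[? ?]; have [] := he u v => //; lra.
move=> /eqP; rewrite mulf_eq0 => /orP[]/eqP h0.
  have [||+ _ _] := he u v; [lra|lra|by rewrite h0 ltxx].
by have := fpos v; rewrite h0 ltxx => /(_ ltac:(lra)).
Unshelve. all: by end_near. Qed.

End KernelUniqueness.

(** * Measures with a density, pushed forward *)

Section WeightedPushforward.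
Context {R : realType}.
Local Notation mu := (@lebesgue_measure R).
Local Open Scope ereal_scope.

(** Both sides of the change of variables formula are integrals against a
    measure of this kind: the image under wmap of the measure with density
    weight on wdom. *)
Record weighted_map := WeightedMap {
  wdom : set R ; wmap : R -> R ; weight : R -> R ;
  measurable_wdom : measurable wdom ;
  measurable_wmap : measurable_fun wdom wmap ;
  measurable_weight : measurable_fun wdom weight ;
  weight_ge0 : forall x, wdom x -> (0 <= weight x)%R }.

Implicit Type m : weighted_map.

Lemma measurable_wdomI m B : measurable B -> measurable (wdom m `&` wmap m @^-1` B).
Proof. by move=> mB; apply: measurable_wmap => //; exact: measurable_wdom. Qed.

Definition wpush m (B : set R) : \bar R :=
  \int[mu]_(x in wdom m `&` wmap m @^-1` B) (weight m x)%:E.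

Section measure.
Variable m : weighted_map.

Let wpush0 : wpush m set0 = 0.
Proof. by rewrite /wpush preimage_set0 setI0 integral_set0. Qed.

Let wpush_ge0 B : 0 <= wpush m B.
Proof. by apply: integral_ge0 => x [Dx _]; rewrite lee_fin weight_ge0. Qed.

Let wpush_sigma_additive : semi_sigma_additive (wpush m).
Proof.
move=> F mF tF mUF; rewrite /wpush preimage_bigcup setI_bigcupr.
rewrite ge0_integral_bigcup//=.
- apply: is_cvg_nneseries => n _ _; exact: wpush_ge0.
- by move=> k; exact: measurable_wdomI.
- apply/measurable_EFinP; apply: (measurable_funS (measurable_wdom m)).
    by apply: bigcup_sub => k _ x [].
  exact: measurable_weight.
- by move=> x [k _ [Dx _]]; rewrite lee_fin weight_ge0.
- apply/trivIsetP => i j _ _ ij; rewrite setIACA setIid -preimage_setI.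
  by move/trivIsetP : tF => /(_ _ _ _ _ ij) ->//; rewrite preimage_set0 setI0.
Qed.

HB.instance Definition _ := isMeasure.Build _ _ _
  (wpush m) wpush0 wpush_ge0 wpush_sigma_additive.

End measure.

Import HBNNSimple.

(** By monotone convergence from simple functions. *)
Lemma integral_wpush m (k : R -> \bar R) :
  measurable_fun setT k -> (forall y, 0 <= k y) ->
  \int[wpush m]_y k y = \int[mu]_(x in wdom m) ((weight m x)%:E * k (wmap m x)).
Proof.
move=> mk k0; have mD := measurable_wdom m.
pose f_ := nnsfun_approx measurableT mk.
have w0 := @weight_ge0 m.
have mw : measurable_fun (wdom m) (EFin \o weight m).
  by apply/measurable_EFinP; exact: measurable_weight.
have mT : measurable_fun (wdom m) (wmap m) := @measurable_wmap m.
transitivity (limn (fun n => \int[wpush m]_x (f_ n x)%:E)).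
  rewrite -monotone_convergence//.
  - apply: eq_integral => y _; apply/esym/cvg_lim => //.
    by apply: cvg_nnsfun_approx.
  - by move=> n; exact/measurable_EFinP/measurable_funP.
  - by move=> n y _; rewrite lee_fin.
  - by move=> y _ i j ij; rewrite lee_fin; exact/lefP/nd_nnsfun_approx.
rewrite [X in limn X](_ : _ = (fun n => \int[mu]_(x in wdom m)
    ((weight m x)%:E * (f_ n (wmap m x))%:E))).
  rewrite -monotone_convergence//; last 3 first.
  - move=> n /=; apply: emeasurable_funM => //.
    by apply/measurable_EFinP; apply: measurableT_comp.
  - by move=> n x Dx; rewrite -EFinM lee_fin mulr_ge0// w0.
  - move=> x Dx i j ij; rewrite -!EFinM lee_fin ler_wpM2l ?w0//.
    exact/lefP/nd_nnsfun_approx.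
  apply: eq_integral => x /[!inE] Dx; apply/cvg_lim => //.
  by apply: cvgeZl => //; apply: cvg_nnsfun_approx.
apply/funext => n.
have mfn r : measurable (wdom m `&` wmap m @^-1` (f_ n @^-1` [set r])).
  exact: measurable_wdomI.
have pos r x : wdom m x -> 0 <= (weight m x)%:E * (r * \1_(f_ n @^-1` [set r]) (wmap m x))%:E.
  move=> Dx; rewrite -EFinM lee_fin mulr_ge0 ?w0// -lee_fin.
  exact: nnfun_muleindic_ge0.
rewrite integralT_nnsfun sintegralE.
under [RHS]eq_integral => x Dx.
  rewrite fimfunE -fsumEFin// ge0_mule_fsumr; last first.
    by move=> r; exact: nnfun_muleindic_ge0.
  over.
have mi r : measurable_fun (wdom m) (fun x => \1_(f_ n @^-1` [set r]) (wmap m x) : R).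
  have mi : measurable_fun setT (\1_(f_ n @^-1` [set r]) : R -> R).
    exact: measurable_indic.
  exact: (measurableT_comp mi mT).
rewrite ge0_integral_fsum//; last first.
  move=> r; apply: emeasurable_funM => //; apply/measurable_EFinP.
  by apply: measurable_funM => //; exact: mi.
apply: eq_fsbigr => r; rewrite inE => -[y _ ry].
have r0 : (0 <= r)%R by rewrite -ry.
transitivity (\int[mu]_(x in wdom m)
   (r%:E * (weight m x * \1_(f_ n @^-1` [set r]) (wmap m x))%:E)).
  rewrite ge0_integralZl_EFin//.
  - congr (_ * _); rewrite /= /wpush integral_mkcondr.
    apply: eq_integral => x _; rewrite patchE indicE.
    have -> : (wmap m x \in f_ n @^-1` [set r]) = (x \in wmap m @^-1` (f_ n @^-1` [set r])).
      by apply/idP/idP; rewrite !inE.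
    by case: ifPn => _; rewrite ?mulr1 ?mulr0.
  - by move=> x Dx; rewrite lee_fin mulr_ge0// w0.
  - apply/measurable_EFinP; apply: measurable_funM; last exact: mi.
    exact: measurable_weight.
by apply: eq_integral => x _; rewrite -!EFinM mulrCA.
Qed.

Lemma integral_wpush_eq m1 m2 (k : R -> \bar R) :
  (forall B, measurable B -> wpush m1 B = wpush m2 B) ->
  measurable_fun setT k -> (forall y, 0 <= k y) ->
  \int[mu]_(x in wdom m1) ((weight m1 x)%:E * k (wmap m1 x)) =
  \int[mu]_(x in wdom m2) ((weight m2 x)%:E * k (wmap m2 x)).
Proof.
move=> m12 mk k0; rewrite -!integral_wpush//.
by apply: eq_measure_integral => B mB _; exact: m12.
Qed.

End WeightedPushforward.

(** * Change of variables along a diffeomorphism of intervals *)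

Section Calculus.
Context {R : realType}.
Implicit Types f g : R -> R.

Lemma derivable_continuous f x : derivable f x 1 -> {for x, continuous f}.
Proof. by move=> /derivable1_diffP/differentiable_continuous. Qed.

Lemma pointwise_continuous_segment f (a b : R) :
  (forall x, a <= x <= b -> {for x, continuous f}) -> {within `[a, b], continuous f}.
Proof.
move=> h; apply: continuous_in_subspaceT => x.
by rewrite inE/= in_itv/=; exact: h.
Qed.

Lemma near_eq_derive1 f g x : (\near x, f x = g x) -> derive1 f x = derive1 g x.
Proof. by move=> fg; rewrite !derive1E; exact: near_eq_derive. Qed.

(** By the intermediate value theorem.  The sign is returned as a factor so that
    increasing and decreasing diffeomorphisms are treated together. *)
Lemma continuous_neq0_sign (D : set R) f : is_interval D ->
  (forall x, D x -> {for x, continuous f}) -> (forall x, D x -> f x != 0) ->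
  exists2 s : R, (s = 1 \/ s = -1) & forall x, D x -> 0 < s * f x.
Proof.
move=> iD cf f0.
have same x y : D x -> D y -> f x < 0 -> 0 < f y -> False.
  move=> Dx Dy fx fy.
  have inD u v z : D u -> D v -> u <= z <= v -> D z by move=> Du Dv; exact: iD.
  have [xy|yx] := leP x y.
    have [||z zxy fz0] := @IVT _ f x y 0 xy.
    - by apply: pointwise_continuous_segment => z hz; apply/cf/(inD x y).
    - by rewrite ge_min (ltW fx)/= le_max (ltW fy) orbT.
    suff /f0 : D z by rewrite fz0 eqxx.
    by apply: (inD x y) => //; move: zxy; rewrite in_itv.
  have [||z zxy fz0] := @IVT _ f y x 0 (ltW yx).
  - by apply: pointwise_continuous_segment => z hz; apply/cf/(inD y x).
  - by rewrite ge_min (ltW fx) orbT/= le_max (ltW fy).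
  suff /f0 : D z by rewrite fz0 eqxx.
  by apply: (inD y x) => //; move: zxy; rewrite in_itv.
have [[x0 [Dx0 fx0]]|h] := EM (exists x, D x /\ f x < 0).
  exists (-1); [by right|move=> x Dx]; rewrite mulN1r oppr_gt0 ltNge.
  apply/negP; rewrite le_eqVlt eq_sym (negbTE (f0 x Dx))/= => fx.
  exact: (same x0 x).
exists 1; [by left|move=> x Dx]; rewrite mul1r ltNge; apply/negP.
by rewrite le_eqVlt (negbTE (f0 x Dx))/= => fx; apply: h; exists x.
Qed.

(** The endpoints are running minima and maxima of an enumeration of the
    rational points of D. *)
Lemma interval_exhaustion (D : set R) x0 : open D -> is_interval D -> D x0 ->
  exists p q : nat -> R, [/\ nonincreasing_seq p, nondecreasing_seq q,
    forall n, [/\ D (p n), D (q n) & p n <= q n] &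
    forall x, D x -> exists n, p n <= x <= q n].
Proof.
move=> oD iD Dx0.
(* Indices which do not encode a rational point of D fall back on x0. *)
pose r n : R := if unpickle n is Some q then
  (if `[< D (ratr q) >] then ratr q else x0) else x0.
have Dr n : D (r n).
  by rewrite /r; case: unpickle => // q; case: asboolP.
pose p := fix p n := if n is m.+1 then Num.min (p m) (r m) else x0.
pose q := fix q n := if n is m.+1 then Num.max (q m) (r m) else x0.
have Dp n : D (p n) by elim: n => //= n; rewrite minEle; case: ifP.
have Dq n : D (q n) by elim: n => //= n; rewrite maxEle; case: ifP.
have px n : p n <= x0 by elim: n => //= n h; rewrite ge_min h.
have qx n : x0 <= q n by elim: n => //= n h; rewrite le_max h.
have nip : nonincreasing_seq p.
  by apply/nonincreasing_seqP => n /=; rewrite ge_min lexx.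
have ndq : nondecreasing_seq q.
  by apply/nondecreasing_seqP => n /=; rewrite le_max lexx.
exists p, q; split => //.
  by move=> n; split => //; exact: le_trans (px n) (qx n).
move=> x Dx.
have /nbhs_ballP[e /= e0 he] : nbhs x D by exact: open_nbhs_nbhs.
have hball y : x - e < y < x + e -> D y.
  by move=> hy; apply: he; rewrite /ball/= distrC ltr_distl.
have [u] := rat_in_itvoo (ltac:(lra) : x - e < x).
have [v] := rat_in_itvoo (ltac:(lra) : x < x + e).
rewrite !in_itv/= => /andP[v1 v2] /andP[u1 u2].
have Du : D (ratr u) by apply: hball; lra.
have Dv : D (ratr v) by apply: hball; lra.
have ru : r (pickle u) = ratr u by rewrite /r pickleK; case: asboolP.
have rv : r (pickle v) = ratr v by rewrite /r pickleK; case: asboolP.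
exists (maxn (pickle u).+1 (pickle v).+1); apply/andP; split.
  apply: (le_trans (nip _ _ (leq_maxl _ _))).
  by rewrite /= ru ge_min (ltW u2) orbT.
apply: le_trans (ndq _ _ (leq_maxr _ _)).
by rewrite /= rv le_max (ltW v1) orbT.
Qed.

End Calculus.

Section Diffeomorphism.
Context {R : realType}.
Variables (D E : set R) (Z X : R -> R).
Hypotheses (oD : open D) (iD : is_interval D) (hZ : diffeomorphism D E Z X).
Local Notation mu := (@lebesgue_measure R).

Let dZ x : D x -> derivable Z x 1. Proof. by case: hZ => _ _ h _ /h[]. Qed.
Let dX z : E z -> derivable X z 1. Proof. by case: hZ => _ _ _ h /h[]. Qed.
Let cdZ x : D x -> {for x, continuous (derive1 Z)}.
Proof. by case: hZ => _ _ h _ /h[]. Qed.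
Let EZ x : D x -> E (Z x). Proof. by case: hZ => h _ _ _ /h[]. Qed.
Let ZK x : D x -> X (Z x) = x. Proof. by case: hZ => h _ _ _ /h[]. Qed.
Let DX z : E z -> D (X z). Proof. by case: hZ => _ h _ _ /h[]. Qed.
Let XK z : E z -> Z (X z) = z. Proof. by case: hZ => _ h _ _ /h[]. Qed.
Let cZ x : D x -> {for x, continuous Z}.
Proof. by move=> /dZ/derivable_continuous. Qed.

Lemma diffeomorphism_derive1 x : D x -> derive1 X (Z x) * derive1 Z x = 1.
Proof.
move=> Dx; rewrite -derive1_comp; [|exact: dZ|by apply: dX; exact: EZ].
rewrite (@near_eq_derive1 _ _ id); first by rewrite derive1_id.
near=> y; apply: ZK; near: y; exact: open_nbhs_nbhs.
Unshelve. all: by end_near. Qed.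

Lemma diffeomorphism_derive1_neq0 x : D x -> derive1 Z x != 0.
Proof.
move=> Dx; apply: contra_eq_neq (diffeomorphism_derive1 Dx) => ->.
by rewrite mulr0 eq_sym oner_eq0.
Qed.

Let within p q x : D p -> D q -> p <= x <= q -> D x.
Proof. by move=> Dp Dq; exact: iD. Qed.

Lemma diffeomorphism_monotone : exists2 s : R, (s = 1 \/ s = -1) &
  (forall x, D x -> `|derive1 Z x| = s * derive1 Z x) /\
  (forall x y, D x -> D y -> x < y -> s * Z x < s * Z y).
Proof.
have [s s1 spos] := continuous_neq0_sign iD cdZ diffeomorphism_derive1_neq0.
exists s => //; split.
  move=> x Dx; have := spos x Dx; case: s1 => ->.
    by rewrite !mul1r => h; rewrite gtr0_norm.
  by rewrite !mulN1r oppr_gt0 => h; rewrite ltr0_norm.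
move=> x y Dx Dy xy.
have dsZ z : x <= z <= y -> derivable (fun u => s * Z u) z 1.
  by move=> h; apply: derivableM => //; apply/dZ/(within Dx Dy).
apply: (@gtr0_derive1_lt_cc _ (fun u => s * Z u) x y) => //.
- by move=> z; rewrite in_itv/= => /andP[? ?]; apply: dsZ; rewrite !ltW.
- move=> z; rewrite in_itv/= => /andP[? ?].
  have Dz : D z by apply: (within Dx Dy); rewrite !ltW.
  have -> : derive1 (fun u => s * Z u) z = s * derive1 Z z.
    by rewrite !derive1E deriveZ//; exact: dZ.
  exact: spos.
- by apply: pointwise_continuous_segment => z hz; apply/derivable_continuous/dsZ.
- by rewrite in_itv/= lexx ltW.
- by rewrite in_itv/= lexx ltW.
Qed.

(** By strict monotonicity and the intermediate value theorem; Z may be decreasing,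
    whence the minimum and the maximum. *)
Lemma diffeomorphism_segment p q : D p -> D q -> p <= q ->
  E `&` X @^-1` `[p, q]%classic = `[Num.min (Z p) (Z q), Num.max (Z p) (Z q)]%classic.
Proof.
move=> Dp Dq pq; apply/seteqP; split => [z [Ez]|z]; rewrite /= !in_itv/=.
  have [s s1 [_ smono]] := diffeomorphism_monotone.
  have wmono x y : D x -> D y -> x <= y -> s * Z x <= s * Z y.
    by move=> Dx Dy; rewrite le_eqVlt => /predU1P[->//|h]; apply/ltW/smono.
  move=> /andP[pX Xq]; have := wmono _ _ Dp (DX Ez) pX.
  have := wmono _ _ (DX Ez) Dq Xq; rewrite XK//.
  rewrite ge_min le_max; case: s1 => ->; rewrite ?mul1r ?mulN1r ?lerN2 => -> ->;
  by rewrite ?orbT.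
move=> hz; have [|c] := IVT pq _ hz.
  by apply: pointwise_continuous_segment => x /(within Dp Dq); exact: cZ.
rewrite in_itv/= => hc <-; have Dc := within Dp Dq hc.
by split; [exact: EZ|rewrite ZK].
Qed.

(** Near Z x0, E contains the image of a segment around x0, which has Z x0 in its
    interior by strict monotonicity. *)
Lemma diffeomorphism_open : open E.
Proof.
rewrite openE => z0 Ez0.
have /nbhs_ballP[e /= e0 he] : nbhs (X z0) D by apply: open_nbhs_nbhs; split => //; exact: DX.
have hball y : X z0 - e < y < X z0 + e -> D y.
  by move=> hy; apply: he; rewrite /ball/= distrC ltr_distl.
pose p := X z0 - e / 2; pose q := X z0 + e / 2.
have e20 : 0 < e / 2 by rewrite divr_gt0.
have Dp : D p by apply: hball; rewrite /p; lra.
have Dq : D q by apply: hball; rewrite /q; lra.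
have pq : p <= q by rewrite /p /q; lra.
have [s s1 [_ smono]] := diffeomorphism_monotone.
have := smono p (X z0) Dp (DX Ez0); rewrite /p => /(_ ltac:(lra)); rewrite -/p XK// => h1.
have := smono (X z0) q (DX Ez0) Dq; rewrite /q => /(_ ltac:(lra)); rewrite -/q XK// => h2.
have hz : z0 \in `]Num.min (Z p) (Z q), Num.max (Z p) (Z q)[.
  rewrite in_itv/= gt_min lt_max; move: h1 h2; case: s1 => ->;
  by rewrite ?mul1r ?mulN1r ?ltrN2 => -> ->; rewrite ?orbT.
apply: (@filterS _ (nbhs z0) _ `]Num.min (Z p) (Z q), Num.max (Z p) (Z q)[%classic).
  move=> z /subset_itv_oo_cc; rewrite -[X in X -> _]/(`[_, _]%classic z).
  by rewrite -diffeomorphism_segment// => -[].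
exact: near_in_itvoo.
Qed.

Lemma integral_derive1_segment p q : D p -> D q -> p <= q ->
  (\int[mu]_(x in `[p, q]) (`|derive1 Z x|)%:E)%E =
  mu (E `&` X @^-1` `[p, q]%classic).
Proof.
move=> Dp Dq pq; rewrite diffeomorphism_segment// lebesgue_measure_itv/= lte_fin.
have [s s1 [sJ smono]] := diffeomorphism_monotone.
move: pq; rewrite le_eqVlt => /predU1P[<-|pq].
  by rewrite set_itv1 integral_set1 minxx maxxx ltxx.
have h := smono p q Dp Dq pq.
have dsZ z : p <= z <= q -> derivable (fun u => s * Z u) z 1.
  by move=> hz; apply: derivableM => //; apply/dZ/(within Dp Dq).
have sub z : z \in `]p, q[ -> p <= z <= q.
  by rewrite in_itv/= => /andP[? ?]; rewrite !ltW.
rewrite (@continuous_FTC2 _ _ (fun u => s * Z u) _ _ pq).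
- rewrite -!EFinB; case: s1 h => ->; rewrite ?mul1r ?mulN1r ?ltrN2 => h.
    by rewrite (min_l (ltW h)) (max_r (ltW h)) h.
  by rewrite (min_r (ltW h)) (max_l (ltW h)) h opprK addrC.
- apply: pointwise_continuous_segment => z hz.
  apply: continuous_comp; first by apply: cdZ; exact: (within Dp Dq).
  exact: norm_continuous.
- split.
  + by move=> z /sub; exact: dsZ.
  + apply: cvg_at_right_filter; apply: (@derivable_continuous _ (fun u => s * Z u)); apply: dsZ.
    by rewrite lexx ltW.
  + apply: cvg_at_left_filter; apply: (@derivable_continuous _ (fun u => s * Z u)); apply: dsZ.
    by rewrite lexx ltW.
- move=> z /sub hz; have Dz := within Dp Dq hz.
  by rewrite sJ// !derive1E deriveZ//; exact: dZ.
Qed.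

Let mE : measurable E. Proof. apply: open_measurable; exact: diffeomorphism_open. Qed.
Let mD : measurable D. Proof. exact: open_measurable. Qed.

Lemma measurable_diffeomorphism_inv : measurable_fun E X.
Proof.
apply: open_continuous_measurable_fun; first exact: diffeomorphism_open.
by move=> z /[!inE] Ez; exact/derivable_continuous/dX.
Qed.

Lemma measurable_diffeomorphism : measurable_fun D Z.
Proof.
by apply: open_continuous_measurable_fun => // x /[!inE]; exact: cZ.
Qed.

Let mJ : measurable_fun D (fun x => `|derive1 Z x|).
Proof.
apply: open_continuous_measurable_fun => // x /[!inE] Dx.
by apply: continuous_comp; [exact: cdZ|exact: norm_continuous].
Qed.

Let mw1 (A : set R) : measurable_fun A (fun=> 1 : R). Proof. exact: measurable_cst. Qed.

Let image_measure (A : set R) (mA : measurable A) (AE : A `<=` E) : weighted_map :=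
  WeightedMap mA (measurable_funS mE AE measurable_diffeomorphism_inv)
    (@mw1 A) (fun _ _ => ler01).

Let jacobian_measure (A : set R) (mA : measurable A) (AD : A `<=` D) : weighted_map :=
  WeightedMap mA (@measurable_id _ _ A) (measurable_funS mD AD mJ)
    (fun x _ => normr_ge0 (derive1 Z x)).

(** Two finite measures on [p, q] are compared: the image under X of Lebesgue
    measure and the measure of density |Z'|.  They agree on [x, q] for every x by
    the fundamental theorem of calculus, and the half-lines [x, +oo[ generate
    the Borel sets and are stable under intersection. *)
Lemma image_measure_segment p q B : D p -> D q -> p <= q -> measurable B ->
  mu (E `&` X @^-1` (`[p, q]%classic `&` B)) =
  (\int[mu]_(x in `[p, q] `&` B) (`|derive1 Z x|)%:E)%E.
Proof.
move=> Dp Dq pq mB.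
have mA : measurable (E `&` X @^-1` `[p, q]%classic).
  by apply: measurable_diffeomorphism_inv => //; exact: measurable_itv.
have AD : `[p, q]%classic `<=` D.
  by move=> x; rewrite /= in_itv/=; exact: within.
pose m1 := image_measure mA (@subIsetl _ _ _).
pose m2 := jacobian_measure (measurable_itv `[p, q]) AD.
have m1E C : measurable C -> wpush m1 C = mu (E `&` X @^-1` (`[p, q]%classic `&` C)).
  move=> mC; rewrite /wpush /= integral_cst ?mul1e ?preimage_setI ?setIA//.
  exact: (measurable_wdomI m1).
have m2E C : wpush m2 C = (\int[mu]_(x in `[p, q] `&` C) (`|derive1 Z x|)%:E)%E by [].
rewrite -m1E// -m2E.
pose g n := `[(- n%:R) : R, +oo[%classic.
have agree x : wpush m1 `[x, +oo[%classic = wpush m2 `[x, +oo[%classic.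
  rewrite m1E ?m2E; last exact: measurable_itv.
  have [qx|xq] := ltP q x.
    have -> : `[p, q]%classic `&` `[x, +oo[%classic = set0.
      apply/seteqP; split => // y [] /=; rewrite !in_itv/= andbT => /andP[_ yq] xy.
      by have := le_lt_trans yq qx; rewrite ltNge xy.
    by rewrite preimage_set0 setI0 measure0 integral_set0.
  have -> : `[p, q]%classic `&` `[x, +oo[%classic = `[Num.max p x, q]%classic.
    apply/seteqP; split => y; rewrite /= !in_itv/= ge_max andbT.
      by move=> [/andP[-> ->] ->].
    by move=> /andP[/andP[-> ->] ->].
  rewrite integral_derive1_segment// ?ge_max ?pq//.
  by apply: (within Dp Dq); rewrite le_max lexx/= ge_max pq.
apply: (measure_unique (@RGenCInfty.G R) g) => //.
- exact: (@RGenCInfty.measurableE R).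
- move=> _ _ [x ->] [y ->]; exists (Num.max x y); apply/seteqP; split => z;
  rewrite /= !in_itv/= !andbT ge_max.
    by move=> [-> ->].
  by move=> /andP[-> ->].
- by move=> n; exists (- n%:R).
- apply/seteqP; split => // x _; exists (Num.truncn `|x|).+1 => //.
  rewrite /g/= in_itv/= andbT lerNl (le_trans (ler_norm _))// normrN ltW//.
  exact: truncnS_gt.
- by move=> _ [x ->]; exact: agree.
- move=> n; apply: (@le_lt_trans _ _ (mu (E `&` X @^-1` `[p, q]%classic))).
    have /= -> := m1E (g n) (measurable_itv _).
    apply: le_measure; rewrite ?inE//.
      apply: measurable_diffeomorphism_inv => //.
      by apply: measurableI; exact: measurable_itv.
    by move=> z [Ez [? ?]].
  rewrite diffeomorphism_segment// lebesgue_measure_itv/=.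
  by case: ifP => _; rewrite ?ltry// -EFinB ltry.
Qed.

(** By monotone convergence along an exhaustion of D by segments. *)
Lemma image_measureE B : measurable B ->
  mu (E `&` X @^-1` B) = (\int[mu]_(x in D `&` B) (`|derive1 Z x|)%:E)%E.
Proof.
move=> mB; have [[x0 Dx0]|D0] := EM (exists x, D x); last first.
  have -> : D = set0 by apply/seteqP; split => // x Dx; apply: D0; exists x.
  have -> : E = set0 by apply/seteqP; split => // z /DX ?; apply: D0; exists (X z).
  by rewrite !set0I measure0 integral_set0.
have [p [q [nip ndq Dpq cov]]] := interval_exhaustion oD iD Dx0.
pose F n := `[p n, q n]%classic `&` B.
have ndF : nondecreasing_seq F.
  move=> m n mn; apply/subsetPset; apply: setSI => x; rewrite /= !in_itv/=.
  by move=> /andP[h1 h2]; rewrite (le_trans (nip _ _ mn))// (le_trans h2)//; exact: ndq.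
have FU : \bigcup_n F n = D `&` B.
  apply/seteqP; split => [x [n _] [/=]|x [Dx Bx]].
    have [Dp Dq _] := Dpq n.
    by rewrite in_itv/= => h Bx; split => //; exact: (within Dp Dq).
  by have [n hn] := cov x Dx; exists n => //; split => //=; rewrite in_itv.
have mF n : measurable (F n) by apply: measurableI => //; exact: measurable_itv.
have mFX n : measurable (E `&` X @^-1` F n) by exact: measurable_diffeomorphism_inv.
have c1 : mu (E `&` X @^-1` F n) @[n --> \oo] --> mu (E `&` X @^-1` B).
  have -> : E `&` X @^-1` B = \bigcup_n (E `&` X @^-1` F n).
    rewrite -setI_bigcupr -preimage_bigcup FU preimage_setI setIA; congr (_ `&` _).
    by apply/seteqP; split => [z Ez|z []//]; split => //; exact: DX.
  apply: nondecreasing_cvg_mu => //; first exact: bigcupT_measurable.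
  move=> m n mn; apply/subsetPset; apply: setIS; apply: preimage_subset.
  exact/subsetPset/ndF.
have FD n : F n `<=` D by move=> x Fx; have [] : (D `&` B) x by rewrite -FU; exists n.
have c2 : (\int[mu]_(x in F n) (`|derive1 Z x|)%:E)%E @[n --> \oo] -->
    (\int[mu]_(x in D `&` B) (`|derive1 Z x|)%:E)%E.
  rewrite -FU; apply: ge0_nondecreasing_set_cvg_integral => //.
  by move=> n; apply/measurable_EFinP; exact: measurable_funS mJ.
apply: cvg_unique c1 _ => //; apply: cvg_trans c2.
rewrite (_ : (fun n => mu _) = (fun n => \int[mu]_(x in F n) (`|derive1 Z x|)%:E)%E)//.
by apply/funext => n; have [Dp Dq pq] := Dpq n; exact: image_measure_segment.
Qed.

(** The change of variables formula.  Measurability of k is only required on D, so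
    k is extended by 0 before the measures are compared. *)
Lemma ge0_integral_diffeomorphism (k : R -> \bar R) : measurable_fun D k ->
  (forall x, D x -> (0 <= k x)%E) ->
  (\int[mu]_(z in E) k (X z) = \int[mu]_(x in D) (`|derive1 Z x|%:E * k x))%E.
Proof.
move=> mk k0.
pose m1 := image_measure mE (@subset_refl _ E).
pose m2 := jacobian_measure mD (@subset_refl _ D).
have m12 B : measurable B -> wpush m1 B = wpush m2 B.
  move=> mB; rewrite [RHS]/wpush/= -image_measureE//.
  rewrite /wpush /= integral_cst ?mul1e//.
  exact: measurable_diffeomorphism_inv.
have mk' : measurable_fun setT (k \_ D).
  exact/(measurable_restrictT _ mD).
have k'0 y : (0 <= (k \_ D) y)%E.
  by rewrite patchE; case: ifPn => // /[!inE]; exact: k0.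
have := integral_wpush_eq m12 mk' k'0; rewrite /= => h.
transitivity (\int[mu]_(z in E) (1%:E * (k \_ D) (X z)))%E.
  by apply: eq_integral => z /[!inE] Ez; rewrite mul1e patchE ifT// inE; exact: DX.
rewrite h; apply: eq_integral => x /[!inE] Dx; by rewrite patchE ifT// inE.
Qed.

End Diffeomorphism.

(** * Transport of a semigroup kernel along a weighted composition operator *)

Section Transport.
Context {R : realType}.
Variables (D E : set R) (Z X c w : R -> R).
Hypotheses (oD : open D) (iD : is_interval D) (hZ : diffeomorphism D E Z X).
Hypotheses (c_gt0 : forall x, D x -> 0 < c x)
  (cont_c : forall x, D x -> {for x, continuous c})
  (wE : forall x, D x -> w x * c x ^+ 2 = `|derive1 Z x|).
Local Notation mu := (@lebesgue_measure R).
Local Notation one := (fun=> 1 : R).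

Let oE : open E. Proof. exact: (diffeomorphism_open oD iD hZ). Qed.
Let mE : measurable E. Proof. exact: open_measurable. Qed.
Let mD : measurable D. Proof. exact: open_measurable. Qed.
Let dZ x : D x -> derivable Z x 1. Proof. by case: hZ => _ _ h _ /h[]. Qed.
Let cdZ x : D x -> {for x, continuous (derive1 Z)}.
Proof. by case: hZ => _ _ h _ /h[]. Qed.
Let EZ x : D x -> E (Z x). Proof. by case: hZ => h _ _ _ /h[]. Qed.
Let ZK x : D x -> X (Z x) = x. Proof. by case: hZ => h _ _ _ /h[]. Qed.
Let DX z : E z -> D (X z). Proof. by case: hZ => _ h _ _ /h[]. Qed.
Let XK z : E z -> Z (X z) = z. Proof. by case: hZ => _ h _ _ /h[]. Qed.
Let c0 x : D x -> c x != 0. Proof. by move=> Dx; rewrite gt_eqF// c_gt0. Qed.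
Let w0 x : D x -> 0 <= w x.
Proof.
move=> Dx; have := normr_ge0 (derive1 Z x).
by rewrite -wE// pmulr_lge0// exprn_gt0// c_gt0.
Qed.
Let mZ : measurable_fun D Z.
Proof. exact: (measurable_diffeomorphism oD hZ). Qed.
Let mX : measurable_fun E X. Proof. exact: (measurable_diffeomorphism_inv oD iD hZ). Qed.

Let measurable_c : measurable_fun D c.
Proof. by apply: open_continuous_measurable_fun => // x /[!inE]; exact: cont_c. Qed.

Let measurable_cV : measurable_fun D (fun x => (c x)^-1).
Proof.
apply: open_continuous_measurable_fun => // x /[!inE] Dx.
exact: continuousV (c0 Dx) (cont_c Dx).
Qed.

Let mcomp_X (f : R -> R) : measurable_fun D f -> measurable_fun E (f \o X).
Proof.
by move=> mf; apply: (measurable_comp mD) mf mX => _ [z Ez <-]; exact: DX.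
Qed.

Let mcomp_Z (f : R -> R) : measurable_fun E f -> measurable_fun D (f \o Z).
Proof.
by move=> mf; apply: (measurable_comp mE) mf mZ => _ [z Ez <-]; exact: EZ.
Qed.

Lemma integral_diffeomorphism (f : R -> R) : measurable_fun E f ->
  (\int[mu]_(z in E) (f z)%:E = \int[mu]_(x in D) (`|derive1 Z x| * f (Z x))%:E)%E.
Proof.
move=> mf.
have key (k : R -> R) : measurable_fun E k -> (forall z, 0 <= k z) ->
    (\int[mu]_(z in E) (k z)%:E = \int[mu]_(x in D) (`|derive1 Z x| * k (Z x))%:E)%E.
  move=> mk k0; transitivity (\int[mu]_(z in E) ((EFin \o k \o Z) (X z)))%E.
    by apply: eq_integral => z /[!inE] Ez /=; rewrite XK.
  rewrite (ge0_integral_diffeomorphism oD iD hZ)//.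
  - by apply/measurable_EFinP; exact: mcomp_Z.
  - by move=> x _; rewrite lee_fin.
rewrite integralE [RHS]integralE; congr (_ - _)%E.
  transitivity (\int[mu]_(z in E) ((f^\+ z)%:E))%E.
    by apply: eq_integral => z _; exact: (congr1 (@^~ z) (funerpos f)).
  rewrite key//; last by apply: measurable_funrpos.
  apply: eq_integral => x _.
  rewrite [RHS](congr1 (@^~ x) (funerpos (fun x => `|derive1 Z x| * f (Z x)))) /=.
  congr EFin; rewrite /funrpos.
  by rewrite maxr_pMr ?mulr0.
transitivity (\int[mu]_(z in E) ((f^\- z)%:E))%E.
  by apply: eq_integral => z _; exact: (congr1 (@^~ z) (funerneg f)).
rewrite key//; last by apply: measurable_funrneg.
apply: eq_integral => x _.
  rewrite [RHS](congr1 (@^~ x) (funerneg (fun x => `|derive1 Z x| * f (Z x)))) /=.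
  congr EFin; rewrite /funrneg.
by rewrite maxr_pMr ?mulr0// mulrN.
Qed.

Lemma integrable_diffeomorphism (f : R -> R) :
  mu.-integrable E (EFin \o f) ->
  mu.-integrable D (fun x => (`|derive1 Z x| * f (Z x))%:E).
Proof.
move=> /integrableP[/measurable_EFinP mf fi]; apply/integrableP; split.
  apply/measurable_EFinP/measurable_funM; last exact: mcomp_Z.
  apply: open_continuous_measurable_fun => // x /[!inE] Dx.
  by apply: continuous_comp; [exact: cdZ|exact: norm_continuous].
apply: le_lt_trans fi.
rewrite /= (@integral_diffeomorphism (fun z => `|f z|))//; last exact: measurableT_comp.
rewrite le_eqVlt; apply/orP; left; apply/eqP.
by apply: eq_integral => x _ /=; rewrite normrM normr_id.
Qed.

(** pull and push are inverse to each other up to the values outside D and E;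
    pull is the isometry from L^2(E, dz) onto L^2(D, w dx) because
    w c^2 = |Z'|. *)
Definition pull (psi : R -> R) (x : R) : R := c x * psi (Z x).
Definition push (f : R -> R) (z : R) : R := f (X z) / c (X z).

Lemma pushK f x : D x -> pull (push f) x = f x.
Proof. by move=> Dx; rewrite /pull /push ZK// mulrC divfK// c0. Qed.

Lemma pullK psi z : E z -> push (pull psi) z = psi z.
Proof. by move=> Ez; rewrite /pull /push XK// mulrC mulKf//; exact/c0/DX. Qed.

Lemma measurable_push f : measurable_fun D f -> measurable_fun E (push f).
Proof.
move=> mf; apply: measurable_funM; first exact: mcomp_X.
exact: (mcomp_X measurable_cV).
Qed.

Lemma measurable_pull psi : measurable_fun E psi -> measurable_fun D (pull psi).
Proof. by move=> mf; apply: measurable_funM => //; exact: mcomp_Z. Qed.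

Lemma sqnorm_push f : measurable_fun D f -> sqnorm E one (push f) = sqnorm D w f.
Proof.
move=> mf; rewrite /sqnorm (@integral_diffeomorphism (fun z => 1 * push f z ^+ 2)).
  apply: eq_integral => x /[!inE] Dx; congr EFin.
  by rewrite /push ZK// -wE//; field; exact: c0.
by apply: measurable_funM => //; apply: measurable_funX; exact: measurable_push.
Qed.

Lemma eq_push f g : (forall x, D x -> f x = g x) -> forall z, E z -> push f z = push g z.
Proof. by move=> fg z Ez; rewrite /push fg//; exact: DX. Qed.

Lemma sqdist_push f g : measurable_fun D f -> measurable_fun D g ->
  sqdist E one (push f) (push g) = sqdist D w f g.
Proof.
move=> mf mg; rewrite /sqdist -[RHS]sqnorm_push; last exact: measurable_funB.
by apply: eq_sqnorm => z _; rewrite /push mulrBl.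
Qed.

Lemma L2_push f : L2 D w f -> L2 E one (push f).
Proof.
by move=> [mf hf]; split; [exact: measurable_push|rewrite sqnorm_push].
Qed.

Lemma L2_pull psi : L2 E one psi -> L2 D w (pull psi).
Proof.
move=> [mf hf]; split; first exact: measurable_pull.
rewrite -sqnorm_push; last exact: measurable_pull.
by rewrite (eq_sqnorm _ (@pullK psi)).
Qed.

(** The factor |Z'| / c comes from the change of variable in the integral against
    push f. *)
Definition transported_kernel (K : R -> R -> R -> R) (t x y : R) : R :=
  c x * K t (Z x) (Z y) * (`|derive1 Z y| / c y).

Lemma transported_kernel_op K t f x : D x ->
  mu.-integrable E (fun z => (K t (Z x) z * push f z)%:E) ->
  mu.-integrable D (fun y => (transported_kernel K t x y * f y)%:E) /\
  kernel_op D (transported_kernel K t) f x = pull (kernel_op E (K t) (push f)) x.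
Proof.
move=> Dx hi; have hi' := integrable_diffeomorphism hi.
have kE y : D y -> (transported_kernel K t x y * f y)%R =
    c x * (`|derive1 Z y| * (K t (Z x) (Z y) * push f (Z y))).
  by move=> Dy; rewrite /transported_kernel /push ZK//; ring.
split.
  have : mu.-integrable D (fun y =>
      (c x)%:E * (`|derive1 Z y| * (K t (Z x) (Z y) * push f (Z y)))%R%:E)%E.
    exact: integrableZl.
  by apply: eq_integrable => // y /[!inE] Dy; rewrite kE.
rewrite /pull /kernel_op /Rintegral integral_diffeomorphism; last first.
  by apply/measurable_EFinP; exact: measurable_int hi.
transitivity (\int[mu]_(y in D) (c x * (`|derive1 Z y| * (K t (Z x) (Z y) * push f (Z y)))))%R.
  by apply: eq_Rintegral => y /[!inE]; exact: kE.
by rewrite RintegralZl.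
Qed.

Variables (O O' : (R -> R) -> R -> R) (B B' : (R -> R) -> Prop).
Hypotheses
  (C2_pull : forall psi, C2_on E psi -> C2_on D (pull psi))
  (C2_push : forall f, C2_on D f -> C2_on E (push f))
  (eq_O : forall f g, (forall x, D x -> f x = g x) -> forall x, D x -> O f x = O g x)
  (eq_B : forall f g, (forall x, D x -> f x = g x) -> B f -> B g)
  (B'E : forall psi, B' psi <-> B (pull psi))
  (intertwine : forall psi, C2_on E psi ->
     forall x, D x -> O (pull psi) x = pull (O' psi) x).

Lemma core_pull psi : operator_core E one O' B' psi -> operator_core D w O B (pull psi).
Proof.
move=> [C2 L L' b]; split; [exact: C2_pull|exact: L2_pull| |exact/B'E].
by apply: eq_L2 (L2_pull L') => x Dx; rewrite intertwine.
Qed.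

Lemma push_intertwine f : C2_on D f -> forall z, E z -> O' (push f) z = push (O f) z.
Proof.
move=> C2 z Ez; rewrite -[LHS]pullK// {1}/push -intertwine//; last 2 first.
- exact: C2_push.
- exact: DX.
by rewrite (eq_O (@pushK f))//; exact: DX.
Qed.

Lemma core_push f : operator_core D w O B f -> operator_core E one O' B' (push f).
Proof.
move=> [C2 L L' b]; split; [exact: C2_push|exact: L2_push| |].
  by apply: eq_L2 (L2_push L') => x Dx; rewrite push_intertwine.
by apply/B'E; apply: eq_B b => x Dx; rewrite pushK.
Qed.

Lemma closure_graph_push f F : L2 D w f -> L2 D w F ->
  closure_graph E one O' B' (push f) (push F) <-> closure_graph D w O B f F.
Proof.
move=> [mf _] [mF _]; split => h e e0; have [u [core h1 h2]] := h e e0.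
  have core' := core_pull core.
  have [C2 [mu' _] [mO _] _] := core; have [_ [mpu _] [mOp _] _] := core'.
  exists (pull u); split => //.
    rewrite -sqdist_push//; apply: le_lt_trans h1.
    rewrite le_eqVlt; apply/orP; left; apply/eqP/eq_sqnorm => z Ez.
    by rewrite pullK.
  rewrite -sqdist_push//; apply: le_lt_trans h2.
  rewrite le_eqVlt; apply/orP; left; apply/eqP/eq_sqnorm => z Ez.
  by rewrite (eq_push (intertwine C2))// pullK.
have core' := core_push core.
have [C2 [mu' _] [mO _] _] := core.
exists (push u); split => //; first by rewrite sqdist_push.
rewrite -(sqdist_push mO mF) in h2; apply: le_lt_trans h2.
rewrite le_eqVlt; apply/orP; left; apply/eqP/eq_sqnorm => z Ez.
by rewrite push_intertwine.
Qed.

Lemma eq_sqdist (A : set R) v f f' g g' :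
  (forall x, A x -> f x = f' x) -> (forall x, A x -> g x = g' x) ->
  sqdist A v f g = sqdist A v f' g'.
Proof. by move=> ff gg; apply: eq_sqnorm => x Ax; rewrite ff// gg. Qed.

(** Each clause of the definition on D is the clause on E for push f: the operators
    with the two kernels are conjugate under pull (transported_kernel_op), norms
    are preserved (sqnorm_push), and the graphs of the closed operators
    correspond (closure_graph_push). *)
Theorem semigroup_kernel_transport K : semigroup_kernel E one O' B' K ->
  semigroup_kernel D w O B (transported_kernel K).
Proof.
move=> [Kcont Kint [M [om KM]] KD [K0 Kgen]].
have Kop t f x : 0 < t -> L2 D w f -> D x ->
    kernel_op D (transported_kernel K t) f x = pull (kernel_op E (K t) (push f)) x.
  move=> t0 Lf Dx; apply: (transported_kernel_op _ _).2 => //.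
  by apply: Kint => //; [exact: L2_push|exact: EZ].
have LKE t f : 0 < t -> L2 D w f -> L2 E one (kernel_op E (K t) (push f)).
  by move=> t0 Lf; have [] := KM t _ t0 (L2_push Lf).
have LK t f : 0 < t -> L2 D w f -> L2 D w (kernel_op D (transported_kernel K t) f).
  by move=> t0 Lf; apply: eq_L2 (L2_pull (LKE t f t0 Lf)) => x Dx; rewrite Kop.
have pushKop t f z : 0 < t -> L2 D w f -> E z ->
    push (kernel_op D (transported_kernel K t) f) z = kernel_op E (K t) (push f) z.
  move=> t0 Lf Ez; rewrite -[RHS]pullK//; apply: eq_push => // x Dx; exact: Kop.
split.
- move=> t x y t0 Dx Dy.
  have cont1 (f : R -> R) : {for x, continuous f} ->
      {for (x, y), continuous (fun p : R * R => f p.1)}.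
    by move=> hf; apply: continuous_comp => //; exact: cvg_fst.
  have cont2 (f : R -> R) : {for y, continuous f} ->
      {for (x, y), continuous (fun p : R * R => f p.2)}.
    by move=> hf; apply: continuous_comp => //; exact: cvg_snd.
  have hc : {for x, continuous c} by exact: cont_c.
  have hc' : {for y, continuous c} by exact: cont_c.
  have hJ : {for y, continuous (fun y => `|derive1 Z y| / c y)}.
    apply: continuousM; last exact: continuousV (c0 Dy) hc'.
    by apply: continuous_comp; [exact: cdZ|exact: norm_continuous].
  apply: cvgM; last exact: (cont2 _ hJ).
  apply: cvgM; first exact: (cont1 _ hc).
  have hK := Kcont t (Z x) (Z y) t0 (EZ Dx) (EZ Dy).
  have hZZ : {for (x, y), continuous (fun p : R * R => (Z p.1, Z p.2))}.
    apply: (@cvg_pair _ _ _ (nbhs (x, y)) (nbhs (Z x)) (nbhs (Z y))).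
      exact: (cont1 _ (derivable_continuous (dZ Dx))).
    exact: (cont2 _ (derivable_continuous (dZ Dy))).
  exact: (continuous_comp hZZ hK).
- move=> t f x t0 Lf Dx; apply: (transported_kernel_op _ _).1 => //.
  by apply: Kint => //; [exact: L2_push|exact: EZ].
- exists M, om => t f t0 Lf; split; first exact: LK.
  have [mK _] := LK t f t0 Lf; have [mf _] := Lf.
  rewrite -sqnorm_push// -(sqnorm_push mf) (eq_sqnorm _ (fun z => pushKop t f z t0 Lf)).
  exact: (KM t _ t0 (L2_push Lf)).2.
- move=> s t f s0 t0 Lf; have st0 : 0 < s + t by exact: addr_gt0.
  have Ltf := LK t f t0 Lf.
  have [m1 _] := LK (s + t) f st0 Lf; have [m2 _] := LK s _ s0 Ltf.
  rewrite -sqdist_push// -[RHS](KD s t _ s0 t0 (L2_push Lf)).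
  apply: eq_sqdist => z Ez; first exact: pushKop.
  rewrite pushKop//; apply: eq_Rintegral => y /[!inE] Ey.
  by rewrite pushKop.
split.
  move=> f Lf; have [mf _] := Lf.
  rewrite ge0_cvge_at_right0P => [e e0|t]; last exact: (sqnorm_ge0 w0).
  have /ge0_cvge_at_right0P h := K0 _ (L2_push Lf).
  have [|d d0 hd] := h _ e e0.
    by move=> t; exact: (@sqnorm_ge0 _ E one (fun _ _ => ler01)).
  exists d => // t td; have /andP[t0 _] := td.
  have [mK _] := LK t f t0 Lf.
  rewrite -sqdist_push//; apply: le_trans (hd t td).
  rewrite le_eqVlt; apply/orP; left; apply/eqP; apply: eq_sqdist => // z Ez.
  exact: pushKop.
move=> f F Lf LF; rewrite -closure_graph_push// -Kgen; [|exact: L2_push|exact: L2_push].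
have [mf _] := Lf; have [mF _] := LF.
have key t : 0 < t ->
    sqdist D w (fun x => t^-1 * (kernel_op D (transported_kernel K t) f x - f x)) F =
    sqdist E one (fun z => t^-1 * (kernel_op E (K t) (push f) z - push f z)) (push F).
  move=> t0; have [mK _] := LK t f t0 Lf.
  rewrite -sqdist_push//; last first.
    by apply: measurable_funM => //; exact: measurable_funB.
  apply: eq_sqdist => // z Ez; rewrite -pushKop// /push; ring.
rewrite !ge0_cvge_at_right0P.
- split => h e e0; have [d d0 hd] := h e e0; exists d => // t /[dup] td /andP[t0 _].
    by rewrite -key//; exact: hd.
  by rewrite key//; exact: hd.
- by move=> t; exact: (@sqnorm_ge0 _ E one (fun _ _ => ler01)).
- by move=> t; exact: (sqnorm_ge0 w0).
Qed.

End Transport.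

(** * Twice continuously differentiable functions *)

Section TwiceDifferentiable.
Context {R : realType}.
Implicit Types (D E : set R) (f g z : R -> R).

(** A form of C2_on with explicit derivatives, which combines under products and
    compositions. *)
Definition has_C2 D f f1 f2 := forall x, D x ->
  [/\ is_derive x 1 f (f1 x), is_derive x 1 f1 (f2 x) & {for x, continuous f2}].

Lemma near_of_open D x (P : R -> Prop) : open D -> D x ->
  (forall y, D y -> P y) -> \forall y \near x, P y.
Proof.
by move=> oD Dx DP; apply: filterS (open_nbhs_nbhs (conj oD Dx)) => y; exact: DP.
Qed.

Lemma has_C2_derive1 D f f1 f2 : open D -> has_C2 D f f1 f2 -> forall x, D x ->
  derive1 f x = f1 x /\ derive1 (derive1 f) x = f2 x.
Proof.
move=> oD C2.
have d1 x : D x -> derive1 f x = f1 x.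
  by move=> Dx; rewrite derive1E; case: (C2 x Dx) => h _ _; exact: derive_val.
move=> x Dx; split; first exact: d1.
rewrite (@near_eq_derive1 _ _ f1); last exact: (near_of_open oD Dx).
by rewrite derive1E; case: (C2 x Dx) => _ h _; exact: derive_val.
Qed.

Lemma has_C2_on D f f1 f2 : open D -> has_C2 D f f1 f2 -> C2_on D f.
Proof.
move=> oD C2 x Dx; have [h1 h2 h3] := C2 x Dx.
have fd y : D y -> derive1 f y = f1 y by move=> /(has_C2_derive1 oD C2)[].
have fdd y : D y -> derive1 (derive1 f) y = f2 y by move=> /(has_C2_derive1 oD C2)[].
split; first exact: ex_derive.
  apply: ex_derive; apply: near_eq_is_derive h2.
  by apply: (near_of_open oD Dx) => y Dy; rewrite fd.
rewrite /prop_for /continuous_at fdd//; apply: cvg_trans h3.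
apply: near_eq_cvg; apply: (near_of_open oD Dx) => y Dy; by rewrite fdd.
Qed.

Lemma C2_on_has_C2 D f : C2_on D f -> has_C2 D f (derive1 f) (derive1 (derive1 f)).
Proof.
move=> C2 x Dx; have [d1 d2 c] := C2 x Dx.
by split; [exact: DeriveDef d1 (esym (derive1E _ _))|
  exact: DeriveDef d2 (esym (derive1E _ _))|exact: c].
Qed.

Lemma has_C2_continuous D f f1 f2 x : has_C2 D f f1 f2 -> D x ->
  [/\ {for x, continuous f}, {for x, continuous f1} & {for x, continuous f2}].
Proof.
by move=> C2 /C2[h1 h2 h3]; split => //; apply: derivable_continuous; exact: ex_derive.
Qed.

Lemma eq_derive1 D f g : open D -> (forall x, D x -> f x = g x) ->
  forall x, D x -> derive1 f x = derive1 g x.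
Proof. by move=> oD fg x Dx; apply: near_eq_derive1; exact: (near_of_open oD Dx). Qed.

Lemma is_derive_mul f g (x a b : R) : is_derive x 1 f a -> is_derive x 1 g b ->
  is_derive x 1 (fun y => f y * g y) (a * g x + f x * b).
Proof.
move=> hf hg; apply: is_derive_eq (is_deriveM hf hg) _.
by rewrite addrC /GRing.scale /= (mulrC (g x)).
Qed.

Lemma is_derive_add f g (x a b : R) : is_derive x 1 f a -> is_derive x 1 g b ->
  is_derive x 1 (fun y => f y + g y) (a + b).
Proof. exact: is_deriveD. Qed.

Lemma is_derive_comp f g (x a b : R) : is_derive (g x) 1 f a -> is_derive x 1 g b ->
  is_derive x 1 (fun y => f (g y)) (a * b).
Proof. exact: is_derive1_comp. Qed.

Lemma has_C2M D f f1 f2 g g1 g2 : has_C2 D f f1 f2 -> has_C2 D g g1 g2 ->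
  has_C2 D (fun x => f x * g x) (fun x => f1 x * g x + f x * g1 x)
    (fun x => f2 x * g x + 2 * f1 x * g1 x + f x * g2 x).
Proof.
move=> Cf Cg x Dx; have [hf1 hf2 cf] := Cf x Dx; have [hg1 hg2 cg] := Cg x Dx.
have [c0 c1 _] := has_C2_continuous Cf Dx; have [k0 k1 _] := has_C2_continuous Cg Dx.
split; first exact: is_derive_mul.
  apply: is_derive_eq (is_derive_add (is_derive_mul hf2 hg1) (is_derive_mul hf1 hg2)) _.
  ring.
apply: cvgD; last exact: cvgM.
by apply: cvgD; [exact: cvgM|apply: cvgM => //; apply: cvgM => //; exact: cvg_cst].
Qed.

Lemma has_C2_comp D E f f1 f2 z z1 z2 : has_C2 E f f1 f2 -> has_C2 D z z1 z2 ->
  (forall x, D x -> E (z x)) ->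
  has_C2 D (fun x => f (z x)) (fun x => f1 (z x) * z1 x)
    (fun x => f2 (z x) * z1 x ^+ 2 + f1 (z x) * z2 x).
Proof.
move=> Cf Cz DE x Dx; have Ez := DE x Dx.
have [hf1 hf2 cf] := Cf _ Ez; have [hz1 hz2 cz] := Cz x Dx.
have [c0 c1 _] := has_C2_continuous Cf Ez; have [k0 k1 _] := has_C2_continuous Cz Dx.
split; first exact: is_derive_comp.
  by apply: is_derive_eq (is_derive_mul (is_derive_comp hf2 hz1) hz2) _; ring.
have q1 := continuous_comp k0 cf; have q2 := continuous_comp k0 c1.
apply: cvgD; last exact: cvgM.
by apply: cvgM => //; apply: cvgM.
Qed.

Lemma has_C2_inv : has_C2 [set x : R | x != 0]
  (fun x => x^-1) (fun x => - x ^- 2) (fun x => 2 * x ^- 3).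
Proof.
move=> x /= x0; split.
- by apply: is_derive_eq (is_deriveV x0 (is_derive_id x 1)) _; rewrite /GRing.scale/= mulr1.
- have h : is_derive x 1 (fun y : R => y ^+ 2) (2 * x).
    apply: is_derive_eq (is_deriveX 2 (is_derive_id x 1)) _.
    by rewrite /GRing.scale/= mulr1 expr1.
  have x20 : x ^+ 2 != 0 by rewrite expf_neq0.
  have := is_deriveN (is_deriveV (f := fun y : R => y ^+ 2) x20 h).
  move=> /is_derive_eq; apply; rewrite /GRing.scale/=; field; exact: x0.
- apply: cvgM; first exact: cvg_cst.
  apply: cvgV; first by rewrite expf_neq0.
  exact: exprn_continuous.
Qed.

Lemma has_C2_powR (a : R) : has_C2 [set x : R | 0 < x]
  (fun x => x `^ a) (fun x => a * x `^ (a - 1)) (fun x => a * ((a - 1) * x `^ (a - 1 - 1))).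
Proof.
move=> x /= x0; have d b := is_derive1_powR b x0.
split; first exact: d.
  by have := is_deriveZ a (d (a - 1)).
apply: cvgM; first exact: cvg_cst.
apply: cvgM; first exact: cvg_cst.
apply: (@derivable_continuous _ (fun y => y `^ (a - 1 - 1))).
exact: (@ex_derive _ _ _ _ _ _ _ (d (a - 1 - 1))).
Qed.

Lemma has_C2_horner (p : {poly R}) :
  has_C2 setT (horner p) (horner p^`()) (horner p^`()^`()).
Proof.
move=> x _; split; [exact: is_derive_poly|exact: is_derive_poly|].
exact: continuous_horner.
Qed.

(** This is max(0, v)^3, written so that its derivatives are obtained from that of
    v |v|. *)
Definition cubic_ramp (v : R) : R := (v ^+ 3 + v * (v * `|v|)) / 2.

Lemma cubic_ramp_le0 v : v <= 0 -> cubic_ramp v = 0.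
Proof. by move=> v0; rewrite /cubic_ramp ler0_norm//; field. Qed.

Lemma cubic_ramp_gt0 v : 0 < v -> 0 < cubic_ramp v.
Proof.
move=> v0; rewrite /cubic_ramp gtr0_norm//.
have -> : (v ^+ 3 + v * (v * v)) / 2 = v ^+ 3 by field.
exact: exprn_gt0.
Qed.

Lemma is_derive_mul_norm (v : R) : is_derive v 1 (fun u => u * `|u|) (2 * `|v|).
Proof.
have sq : is_derive v 1 (fun u : R => u ^+ 2) (2 * v).
  apply: is_derive_eq (is_deriveX 2 (is_derive_id v 1)) _.
  by rewrite /GRing.scale/= mulr1 expr1.
have [v0|v0|->] := ltgtP v 0.
- rewrite ltr0_norm// mulrN; apply: near_eq_is_derive (is_deriveN sq).
  by near=> u; rewrite ltr0_norm ?mulrN//; near: u; exact: lt_nbhsl.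
- rewrite gtr0_norm//; apply: near_eq_is_derive sq.
  by near=> u; rewrite gtr0_norm//; near: u; exact: lt_nbhsr.
(* At 0 the difference quotient of u |u| is |u|. *)
- rewrite normr0 mulr0; apply/is_derive1_caratheodory.
  exists (fun u => `|u|); split; last exact: normr0.
    by move=> u; rewrite mul0r !subr0 mulrC.
  exact: norm_continuous.
Unshelve. all: by end_near. Qed.

Lemma has_C2_cubic_ramp : has_C2 setT cubic_ramp
  (fun v => 3 / 2 * (v ^+ 2 + v * `|v|)) (fun v => 3 * (v + `|v|)).
Proof.
move=> v _.
have did : is_derive v 1 (fun u : R => u) 1 by exact: is_derive_id.
have d2 : is_derive v 1 (fun u : R => u ^+ 2) (2 * v).
  apply: is_derive_eq (is_deriveX 2 did) _.
  by rewrite /GRing.scale/= mulr1 expr1.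
have d3 : is_derive v 1 (fun u : R => u ^+ 3) (3 * v ^+ 2).
  apply: is_derive_eq (is_deriveX 3 did) _.
  by rewrite /GRing.scale/= mulr1.
have dn := is_derive_mul_norm v.
have dc (k : R) : is_derive v 1 (fun=> k) 0 by exact: is_derive_cst.
split.
- apply: is_derive_eq (is_derive_mul (is_derive_add d3 (is_derive_mul did dn)) (dc 2^-1)) _.
  by field.
- apply: is_derive_eq (is_derive_mul (dc (3 / 2)) (is_derive_add d2 dn)) _.
  by field.
- apply: cvgM; first exact: cvg_cst.
  by apply: cvgD; [exact: cvg_id|exact: norm_continuous].
Qed.

Lemma exists_C2_bump (a b : R) : a < b -> exists f f1 f2 : R -> R, [/\ has_C2 setT f f1 f2,
  forall x, 0 <= f x, forall x, a < x < b -> 0 < f x &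
  forall x, ~ (a < x < b) -> [/\ f x = 0, f1 x = 0 & f2 x = 0]].
Proof.
move=> ab; pose p : {poly R} := ('X - a%:P) * (b%:P - 'X).
have pE x : p.[x] = (x - a) * (b - x) by rewrite !hornerE.
do 3 eexists; split.
- exact: has_C2_comp has_C2_cubic_ramp (has_C2_horner p) _.
- move=> x /=; have [/cubic_ramp_le0 ->//|/cubic_ramp_gt0/ltW//] := leP p.[x] 0.
- move=> x /andP[ax xb]; apply: cubic_ramp_gt0.
  by rewrite pE mulr_gt0// subr_gt0.
- move=> x nx /=.
  have p0 : p.[x] <= 0.
    rewrite pE leNgt; apply/negP => h; apply: nx.
    have [ax|xa] := ltP a x.
      by move: h; rewrite pmulr_rgt0 ?subr_gt0// => ->.
    have [xb|bx] := ltP x b.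
      by move: h; rewrite pmulr_lgt0 ?subr_gt0// ltNge xa.
    by have := le_trans bx xa; rewrite leNgt ab.
  by split; [exact: cubic_ramp_le0| |]; rewrite ler0_norm//; ring.
Qed.
End TwiceDifferentiable.

(** * The Liouville transformation of the diffusion *)

(** The integrand of the squared norm is continuous on the compact [a, b] and
    vanishes elsewhere. *)
Lemma L2_segment (R : realType) (D : set R) (w k : R -> R) (a b : R) :
  open D -> (forall x, a <= x <= b -> D x) ->
  (forall x, D x -> {for x, continuous w}) ->
  (forall x, D x -> {for x, continuous k}) ->
  (forall x, D x -> ~ (a < x < b) -> k x = 0) -> L2 D w k.
Proof.
move=> oD abD cw ck k0; have mD : measurable D by exact: open_measurable.
have cwk x : D x -> {for x, continuous (fun x => w x * k x ^+ 2)}.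
  move=> Dx; apply: cvgM; first exact: cw.
  apply: (@cvg_comp _ _ _ k (fun y => y ^+ 2)); first exact: ck.
  exact: exprn_continuous.
split; first by apply: open_continuous_measurable_fun => // x /[!inE]; exact: ck.
have int_ab : (@lebesgue_measure R).-integrable `[a, b] (EFin \o (fun x => w x * k x ^+ 2)).
  apply: continuous_compact_integrable; first exact: segment_compact.
  by apply: pointwise_continuous_segment => x /abD; exact: cwk.
have -> : sqnorm D w k = (\int[@lebesgue_measure R]_(x in `[a, b]) (w x * k x ^+ 2)%:E)%E.
  have -> : `[a, b]%classic = D `&` `[a, b]%classic.
    by apply/seteqP; split => x /=; rewrite in_itv/=; [split => //; exact: abD|case].
  rewrite [RHS]integral_mkcondr; apply: eq_integral => x /[!inE] Dx.
  rewrite patchE; case: ifPn => //; rewrite notin_setE/= in_itv/= => h.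
  rewrite k0// ?expr0n ?mulr0// => /andP[ax xb]; apply: h.
  by rewrite !ltW.
have : (\int[@lebesgue_measure R]_(x in `[a, b]) (w x * k x ^+ 2)%:E)%E \is a fin_num.
  by apply: integrable_fin_num int_ab; exact: measurable_itv.
by rewrite fin_numE => /andP[_]; rewrite -ltey.
Qed.

Lemma eq_boundary_conditions (R : realType) (D : set R) (h : R -> R) bl br (f g : R -> R) :
  open D -> (forall x, D x -> f x = g x) ->
  boundary_conditions D h bl br f -> boundary_conditions D h bl br g.
Proof.
move=> oD fg.
have fg' : forall x, D x -> h x ^+ 2 * derive1 f x = h x ^+ 2 * derive1 g x.
  by move=> x Dx; rewrite (eq_derive1 oD fg).
have left_end u v : (forall x, D x -> u x = v x) ->
    vanishes_at_left_end D u -> vanishes_at_left_end D v.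
  by move=> uv H e /H[k Dk Hk]; exists k => // x Dx xk; rewrite -uv//; exact: Hk.
have right_end u v : (forall x, D x -> u x = v x) ->
    vanishes_at_right_end D u -> vanishes_at_right_end D v.
  by move=> uv H e /H[k Dk Hk]; exists k => // x Dx xk; rewrite -uv//; exact: Hk.
move=> [Hl Hr]; split.
  by case: bl Hl => //=; exact: left_end.
by case: br Hr => //=; exact: right_end.
Qed.

Lemma boundary_conditions_segment (R : realType) (D : set R) (h f : R -> R) bl br a b :
  D a -> D b ->
  (forall x, D x -> ~ (a < x < b) -> f x = 0 /\ derive1 f x = 0) ->
  boundary_conditions D h bl br f.
Proof.
move=> Da Db f0; split.
  have f0l x : D x -> x < a -> f x = 0 /\ derive1 f x = 0.
    by move=> Dx xa; apply: f0 => // /andP[]; rewrite ltNge (ltW xa).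
  case: bl => //= e e0; exists a => // x Dx xa; have [fx f'x] := f0l x Dx xa.
    by rewrite fx normr0.
  by rewrite f'x mulr0 normr0.
have f0r x : D x -> b < x -> f x = 0 /\ derive1 f x = 0.
  by move=> Dx xb; apply: f0 => // /andP[_]; rewrite ltNge (ltW xb).
case: br => //= e e0; exists b => // x Dx xb; have [fx f'x] := f0r x Dx xb.
  by rewrite fx normr0.
by rewrite f'x mulr0 normr0.
Qed.

Section Liouville.
Context {R : realType}.
Variables (A P S : {poly R}) (xi : R) (D E : set R) (h Z X : R -> R)
  (bl br : boundary_behaviour).
Hypotheses (oD : open D) (iD : is_interval D)
  (P_ge0 : forall x, D x -> 0 <= P.[x])
  (h_gt0 : forall x, D x -> 0 < h x) (h_C2 : C2_on D h)
  (h_ode : forall x, D x ->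
     A.[x] ^+ 2 / P.[x] * derive1 (derive1 h) x + S.[x] / P.[x] * h x = xi * h x)
  (hZ : diffeomorphism D E Z X)
  (Z' : forall x, D x -> derive1 Z x = Num.sqrt P.[x] / A.[x]).

Let EZ x : D x -> E (Z x). Proof. by case: hZ => H _ _ _ /H[]. Qed.
Let ZK x : D x -> X (Z x) = x. Proof. by case: hZ => H _ _ _ /H[]. Qed.
Let DX z : E z -> D (X z). Proof. by case: hZ => _ H _ _ /H[]. Qed.
Let XK z : E z -> Z (X z) = z. Proof. by case: hZ => _ H _ _ /H[]. Qed.
Let dZ x : D x -> derivable Z x 1. Proof. by case: hZ => _ _ H _ /H[]. Qed.
Let dX0 z : E z -> derivable X z 1. Proof. by case: hZ => _ _ _ H /H[]. Qed.
Let oE : open E. Proof. exact: (diffeomorphism_open oD iD hZ). Qed.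

Let a2 x := A.[x] ^+ 2 / P.[x].
Let G x := a2 x `^ (1 / 4).
Let c x := G x / h x.
Let w := speed_density A P h.
Let h1 := derive1 h.
Let h2 := derive1 h1.
Let G1 := derive1 G.
Let G2 := derive1 G1.

(** A diffeomorphism has no critical point, so A and P cannot vanish on D. *)
Let AP x : D x -> A.[x] != 0 /\ 0 < P.[x].
Proof.
move=> Dx; have := diffeomorphism_derive1_neq0 oD hZ Dx.
rewrite Z'// mulf_eq0 negb_or invr_eq0 => /andP[h0 ->]; split => //.
by rewrite lt_neqAle P_ge0// andbT eq_sym; apply: contraNneq h0 => ->; rewrite sqrtr0.
Qed.

Let a2_gt0 x : D x -> 0 < a2 x.
Proof. by move=> /AP[? ?]; rewrite divr_gt0// exprn_even_gt0. Qed.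

Let G_gt0 x : D x -> 0 < G x. Proof. by move=> /a2_gt0; exact: powR_gt0. Qed.
Let G_neq0 x : D x -> G x != 0. Proof. by move=> Dx; rewrite gt_eqF// G_gt0. Qed.
Let h_neq0 x : D x -> h x != 0. Proof. by move=> Dx; rewrite gt_eqF// h_gt0. Qed.

Let G4 x : D x -> G x ^+ 4 = a2 x.
Proof.
move=> Dx; rewrite -powR_mulrn ?powR_ge0// -powRrM.
by rewrite (_ : 1 / 4 * 4%:R = 1); [rewrite powRr1// ltW// a2_gt0|field].
Qed.

Let normZ' x : D x -> `|derive1 Z x| = (G x ^+ 2)^-1.
Proof.
move=> Dx; have [A0 P0] := AP Dx.
have G20 : 0 <= (G x ^+ 2)^-1 by rewrite invr_ge0 sqr_ge0.
apply/eqP; rewrite -(@eqrXn2 _ 2)//; apply/eqP.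
rewrite real_normK ?num_real// Z'// exprMn sqr_sqrtr ?(ltW P0)//.
have -> : (G x ^+ 2)^-1 ^+ 2 = (G x ^+ 4)^-1 by rewrite exprVn -exprM.
by rewrite G4// /a2 invf_div exprVn.
Qed.

Let sw x : D x -> w x * c x ^+ 2 = `|derive1 Z x|.
Proof.
move=> Dx; have [A0 P0] := AP Dx; rewrite normZ'// /w /speed_density /c.
have -> : P.[x] / A.[x] ^+ 2 = (G x ^+ 4)^-1 by rewrite G4// /a2 invf_div.
by field; rewrite h_neq0// G_neq0.
Qed.

Let C2S (D1 D2 : set R) f f1 f2 : D2 `<=` D1 -> has_C2 D1 f f1 f2 -> has_C2 D2 f f1 f2.
Proof. by move=> D12 C2 x /D12; exact: C2. Qed.

Let C2h : has_C2 D h h1 h2. Proof. exact: C2_on_has_C2. Qed.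

Let C2G : has_C2 D G G1 G2.
Proof.
have C2p (p : {poly R}) : has_C2 D (horner p) (horner p^`()) (horner p^`()^`()).
  by apply: C2S (has_C2_horner p).
have CV := has_C2_comp has_C2_inv (C2p P)
  (fun x Dx => lt0r_neq0 (AP Dx).2).
have Ca := has_C2M (has_C2M (C2p A) (C2p A)) CV.
apply: C2_on_has_C2; apply: has_C2_on => //.
apply: (has_C2_comp (has_C2_powR (1 / 4)) _ a2_gt0).
exact: Ca.
Qed.

Let Ch x : D x -> [/\ {for x, continuous h}, {for x, continuous h1} & {for x, continuous h2}].
Proof. exact: has_C2_continuous. Qed.
Let CG x : D x -> [/\ {for x, continuous G}, {for x, continuous G1} & {for x, continuous G2}].
Proof. exact: has_C2_continuous. Qed.

Let dcst (k x : R) : is_derive x 1 (fun=> k) 0. Proof. exact: is_derive_cst. Qed.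

(** The constant s is the sign of A, so that Z' = s / G^2 is smooth without
    absolute values. *)
Let sign : exists2 s : R, s ^+ 2 = 1 & forall x, D x -> derive1 Z x = s * (G x * G x)^-1.
Proof.
have [s s1 [Zs _]] := diffeomorphism_monotone oD iD hZ.
exists s; first by case: s1 => ->; rewrite ?expr1n ?sqrrN ?expr1n.
move=> x Dx; rewrite -expr2 -normZ'// Zs// mulrA -expr2.
by case: s1 => ->; rewrite ?sqrrN expr1n mul1r.
Qed.

Let C2Z s : s ^+ 2 = 1 -> (forall x, D x -> derive1 Z x = s * (G x * G x)^-1) ->
  has_C2 D Z (fun x => s * (G x * G x)^-1) (fun x => - (2 * s) * G1 x * (G x)^-1 ^+ 3).
Proof.
move=> s1 Zs.
have CK := has_C2_comp has_C2_inv C2G G_neq0.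
move=> x Dx; have [dK _ _] := CK x Dx; have [cG cG1 _] := CG Dx.
have G0 := G_neq0 Dx.
split.
- rewrite -(Zs x Dx); exact: DeriveDef (dZ Dx) (esym (derive1E _ _)).
- have d := is_derive_mul (dcst s x) (is_derive_mul dK dK).
  apply: near_eq_is_derive (is_derive_eq d _).
    by near=> y; rewrite invfM.
  by rewrite mul0r add0r; field.
- apply: cvgM; first by apply: cvgM => //; exact: cvg_cst.
  apply: (@cvg_comp _ _ _ (fun y => (G y)^-1) (fun y => y ^+ 3)).
    exact: (continuousV G0 cG).
  exact: exprn_continuous.
Unshelve. all: by end_near. Qed.

Let C2X s : s ^+ 2 = 1 -> (forall x, D x -> derive1 Z x = s * (G x * G x)^-1) ->
  has_C2 E X (fun z => s * (G (X z) * G (X z))) (fun z => 2 * G1 (X z) * G (X z) ^+ 3).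
Proof.
move=> s1 Zs.
have dX z : E z -> is_derive z 1 X (s * (G (X z) * G (X z))).
  move=> Ez; have Dx := DX Ez; have G0 := G_neq0 Dx.
  have : derive1 X z = s * (G (X z) * G (X z)).
    have := diffeomorphism_derive1 oD hZ Dx; rewrite XK// Zs// => e.
    have s0 : s != 0 by apply: contra_eq_neq s1 => ->; rewrite expr0n eq_sym oner_neq0.
    rewrite -[LHS]mulr1 -s1.
    have -> : derive1 X z * s ^+ 2 = (derive1 X z * (s * (G (X z) * G (X z))^-1)) * (s * (G (X z) * G (X z))).
      by field.
    by rewrite e mul1r.
  move=> <-; exact: DeriveDef (dX0 Ez) (esym (derive1E _ _)).
move=> z Ez; have Dx := DX Ez; have [dG _ _] := C2G Dx; have [cG cG1 _] := CG Dx.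
have cX : {for z, continuous X}.
  by apply: derivable_continuous; exact: (@ex_derive _ _ _ _ _ _ _ (dX z Ez)).
split; first exact: dX.
- have dGX := is_derive_comp dG (dX z Ez).
  apply: is_derive_eq (is_derive_mul (dcst s z) (is_derive_mul dGX dGX)) _.
  transitivity (s ^+ 2 * (2 * G1 (X z) * G (X z) ^+ 3)); last by rewrite s1 mul1r.
  by rewrite mul0r add0r; ring.
- have c1 := continuous_comp cX cG1; have c0 := continuous_comp cX cG.
  apply: cvgM; first by apply: cvgM => //; exact: cvg_cst.
  apply: (@cvg_comp _ _ _ (fun y => G (X y)) (fun y => y ^+ 3)); first exact: c0.
  exact: exprn_continuous.
Qed.


Let gaugeE s z : s ^+ 2 = 1 -> (forall x, D x -> derive1 Z x = s * (G x * G x)^-1) ->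
  E z -> log_gauge' A P X z = s * (G1 (X z) * G (X z)).
Proof.
move=> s1 Zs Ez; have C2g := has_C2_comp C2G (C2X s1 Zs) DX.
have [d _] := has_C2_derive1 oE C2g Ez.
have G0 := G_neq0 (DX Ez).
rewrite /log_gauge' -[gauge A P X]/(fun z => G (X z)) d.
by field.
Qed.

(** The function (g'/g)^2 - (g'/g)' of z is - G'' G^3 in terms of x. *)
Let potential1E x : D x ->
  potential1 A P S X xi (Z x) = - (G2 x * G x ^+ 3) - S.[x] / P.[x] + xi.
Proof.
move=> Dx; have [s s1 Zs] := sign; have Ez := EZ Dx.
have [dX _ _] := C2X s1 Zs Ez; have [dG dG1 _] := C2G (DX Ez).
have d := is_derive_mul (dcst s (Z x))
  (is_derive_mul (is_derive_comp dG1 dX) (is_derive_comp dG dX)).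
rewrite /potential1 (gaugeE s1 Zs Ez).
rewrite (@eq_derive1 _ E _ (fun z => s * (G1 (X z) * G (X z))) oE)//; last first.
  by move=> z; exact: gaugeE.
rewrite derive1E (@derive_val _ _ _ _ _ _ _ d) ZK//.
congr (_ - _ + _).
transitivity (s ^+ 2 * (- (G2 x * G x ^+ 3))); last by rewrite s1 mul1r.
by rewrite mul0r add0r; ring.
Qed.

Let C2c : has_C2 D c _ _ := has_C2M C2G (has_C2_comp has_C2_inv C2h h_neq0).

Let C2pull s psi : s ^+ 2 = 1 -> (forall x, D x -> derive1 Z x = s * (G x * G x)^-1) ->
  C2_on E psi -> has_C2 D (pull Z c psi) _ _ :=
  fun s1 Zs Cpsi => has_C2M C2c (has_C2_comp (C2_on_has_C2 Cpsi) (C2Z s1 Zs) EZ).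

(** In the generator applied to (G/h) (psi o Z), the terms with psi' cancel because
    G^2 Z' = s is constant, psi'' has coefficient (G/h) G^4 Z'^2 = G/h, and the
    terms with psi are (G/h) (G'' G^3 - G^4 h''/h) psi; the equation satisfied by h
    turns G^4 h''/h into xi - S/P. *)
Lemma liouville_intertwine psi x : C2_on E psi -> D x ->
  generator A P h (pull Z c psi) x =
  c x * (derive1 (derive1 psi) (Z x) - potential1 A P S X xi (Z x) * psi (Z x)).
Proof.
move=> Cpsi Dx; have [s s1 Zs] := sign.
have [d1 d2] := has_C2_derive1 oD (C2pull s1 Zs Cpsi) Dx.
rewrite /generator d1 d2 potential1E// -/(a2 x) -G4// -/h1.
have -> : S.[x] / P.[x] = xi - G x ^+ 4 * h2 x / h x.
  have := h_ode Dx; rewrite -/(a2 x) -G4// => e.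
  apply: (mulIf (h_neq0 Dx)); rewrite mulrBl -e divfK ?h_neq0//.
  by rewrite addrC /h2 /h1; ring.
rewrite [in RHS](_ : derive1 (derive1 psi) (Z x) = s ^+ 2 * derive1 (derive1 psi) (Z x));
  last by rewrite s1 mul1r.
rewrite /c; field; rewrite G_neq0// h_neq0//.
Qed.


Let C2push f : C2_on D f -> C2_on E (push X c f).
Proof.
move=> Cf; have [s s1 Zs] := sign.
have c_neq0 x : D x -> c x != 0 by move=> Dx; rewrite mulf_neq0// ?invr_eq0 ?G_neq0 ?h_neq0.
have C2fc := has_C2M (C2_on_has_C2 Cf) (has_C2_comp has_C2_inv C2c c_neq0).
exact: has_C2_on oE (has_C2_comp C2fc (C2X s1 Zs) DX).
Qed.

Let cont_a2 x : D x -> {for x, continuous a2}.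
Proof.
move=> Dx; have [A0 P0] := AP Dx; apply: cvgM.
  apply: (@cvg_comp _ _ _ (horner A) (fun y => y ^+ 2)); first exact: continuous_horner.
  exact: exprn_continuous.
apply: continuousV; [by rewrite gt_eqF|exact: continuous_horner].
Qed.

Let cont_w x : D x -> {for x, continuous w}.
Proof.
move=> Dx; have [A0 P0] := AP Dx; have [ch _ _] := Ch Dx; apply: cvgM.
  apply: (@cvg_comp _ _ _ h (fun y => y ^+ 2)); first exact: ch.
  exact: exprn_continuous.
apply: cvgM; first exact: continuous_horner.
apply: (@continuousV _ _ (fun y => A.[y] ^+ 2)); first by rewrite expf_neq0.
apply: (@cvg_comp _ _ _ (horner A) (fun y => y ^+ 2)); first exact: continuous_horner.
exact: exprn_continuous.
Qed.

Let w_gt0 x : D x -> 0 < w x.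
Proof.
move=> Dx; have [A0 P0] := AP Dx; rewrite mulr_gt0 ?exprn_gt0 ?h_gt0// divr_gt0//.
by rewrite exprn_even_gt0.
Qed.

(** The function q is the killing rate: 0 for the generator and Q/P for the
    Feynman-Kac operator. *)
Variables (q : R -> R) (O O' : (R -> R) -> R -> R).
Hypotheses (cont_q : forall x, D x -> {for x, continuous q})
  (OE : forall f x, D x -> O f x = generator A P h f x - q x * f x)
  (O'E : forall psi z, E z ->
    O' psi z = - (schrodinger (fun z => potential1 A P S X xi z + q (X z)) psi z)).

Let Bx := boundary_conditions D h bl br.

Let core_bump a b : a < b -> (forall x, a <= x <= b -> D x) ->
  exists f, [/\ operator_core D w O Bx f, forall x, D x -> 0 <= f x,
    forall x, a < x < b -> 0 < f x & forall x, ~ (a < x < b) -> f x = 0].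
Proof.
move=> ab abD; have [f [f1 [f2 [C2f f0 fpos fz]]]] := exists_C2_bump ab.
have C2fD : has_C2 D f f1 f2 by apply: C2S C2f.
have fE := has_C2_derive1 oD C2fD.
have OfE x : D x -> O f x = a2 x * f2 x + 2 * (h1 x * (h x)^-1) * a2 x * f1 x - q x * f x.
  by move=> Dx; have [e1 e2] := fE x Dx; rewrite OE// /generator e1 e2.
exists f; split; [|by move=> u _; exact: f0|exact: fpos|by move=> u /fz[]].
split; first exact: (has_C2_on oD C2fD).
- apply: (L2_segment oD abD cont_w) => x Dx; first by have [] := has_C2_continuous C2fD Dx.
  by move=> /fz[].
- apply: (@eq_L2 _ D w (fun x => a2 x * f2 x + 2 * (h1 x * (h x)^-1) * a2 x * f1 x - q x * f x)).
    by move=> x Dx; rewrite OfE.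
  apply: (L2_segment oD abD cont_w) => x Dx; last first.
    by move=> /fz[-> -> ->]; rewrite !mulr0 addr0 subrr.
  have [c0 k1 k2] := has_C2_continuous C2fD Dx; have [ch ch1 _] := Ch Dx.
  have ca := cont_a2 Dx; have cq := cont_q Dx.
  have ch' : {for x, continuous (fun y => (h y)^-1)} := continuousV (h_neq0 Dx) ch.
  apply: cvgB; last exact: cvgM.
  apply: cvgD; first exact: cvgM.
  apply: cvgM => //; apply: cvgM => //; apply: cvgM; first exact: cvg_cst.
  exact: cvgM.
- apply: (@boundary_conditions_segment _ D h f bl br a b).
  + by apply: abD; rewrite lexx ltW.
  + by apply: abD; rewrite lexx ltW.
  + by move=> x Dx /fz[-> e1 _]; rewrite (fE x Dx).1.
Qed.

(** The kernel of the diffusion and the transported Schrodinger kernel both belong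
    to O on L^2(D, w dx), hence coincide; c(x) |Z' y| / c(y) is the announced
    factor since |Z'| = G^-2 and c = G/h. *)
Lemma kernel_relation (pL KH : R -> R -> R -> R) t x y :
  semigroup_kernel D w O Bx pL ->
  semigroup_kernel E (fun=> 1) O' (transported_conditions A P h X Z Bx) KH ->
  0 < t -> D x -> D y ->
  pL t x y = h y / h x * (A.[x] ^+ 2 / P.[x]) `^ (1 / 4)
    * (P.[y] / A.[y] ^+ 2) `^ (3 / 4) * KH t (Z x) (Z y).
Proof.
move=> sL sH t0 Dx Dy.
have c_gt0 u : D u -> 0 < c u by move=> Du; rewrite divr_gt0 ?G_gt0 ?h_gt0.
have cont_c u : D u -> {for u, continuous c}.
  by move=> Du; have [] := has_C2_continuous C2c Du.
have mD : measurable D by exact: open_measurable.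
have mw : measurable_fun D w.
  by apply: open_continuous_measurable_fun => // u /[!inE]; exact: cont_w.
have w_ge0 u : D u -> 0 <= w u by move=> /w_gt0/ltW.
have gaugeZ u : D u -> gauge A P X (Z u) / h u = c u.
  by move=> Du; rewrite /gauge ZK.
have sK : semigroup_kernel D w O Bx (transported_kernel Z c KH).
  apply: (semigroup_kernel_transport oD iD hZ c_gt0 cont_c sw _ C2push _ _ _ _ sH).
  - move=> psi Cpsi; have [s s1 Zs] := sign; exact: has_C2_on oD (C2pull s1 Zs Cpsi).
  - move=> f g fg u Du; have e1 := eq_derive1 oD fg; have e2 := eq_derive1 oD e1.
    by rewrite !OE// /generator (fg u Du) (e1 u Du) (e2 u Du).
  - by move=> f g fg; exact: eq_boundary_conditions.
  - move=> psi; split; apply: eq_boundary_conditions => // u Du;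
    by rewrite /pull gaugeZ.
  - move=> psi Cpsi u Du; rewrite OE// liouville_intertwine// /pull O'E; last exact: EZ.
    by rewrite /schrodinger ZK//; ring.
have -> : pL t x y = transported_kernel Z c KH t x y.
  apply/le_anti/andP; split.
  - exact: (semigroup_kernel_le mD mw w_ge0 oD w_gt0 core_bump sL sK).
  - exact: (semigroup_kernel_le mD mw w_ge0 oD w_gt0 core_bump sK sL).
have G3 : (P.[y] / A.[y] ^+ 2) `^ (3 / 4) = (G y ^+ 3)^-1.
  have -> : P.[y] / A.[y] ^+ 2 = (a2 y)^-1 by rewrite /a2 invf_div.
  rewrite -powR_inv1 ?ltW ?a2_gt0// -powRrM.
  have -> : -1 * (3 / 4) = - (1 / 4 * 3%:R) :> R by field.
  by rewrite powRN powRrM powR_mulrn// powR_ge0.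
rewrite /transported_kernel normZ'// G3 -/(G x) /c.
by field; rewrite !G_neq0// !h_neq0.
Qed.

End Liouville.

Theorem theorem16 (R : realType)
  (A P S : {poly R}) (Q : R -> {poly R}) (theta xi : R)
  (Dx Dz : set R) (h Z X : R -> R) (bl br : boundary_behaviour)
  (hA : A \in [:: 1; 'X; 'X * (1 - 'X); 'X ^+ 2 + 1])
  (hP : (size P <= 3)%N) (hS : (size S <= 3)%N)
  (hQ : forall th : R, (size (Q th) <= 3)%N)
  (htheta : theta != 0)
  (hDx_open : open Dx) (hDx_itv : is_interval Dx)
  (hP_ge0 : forall x, Dx x -> 0 <= P.[x])
  (hh_pos : forall x, Dx x -> 0 < h x)
  (hh_C2 : C2_on Dx h)
  (hh_ode : forall x, Dx x ->
     A.[x] ^+ 2 / P.[x] * derive1 (derive1 h) x + S.[x] / P.[x] * h x = xi * h x)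
  (hZ : diffeomorphism Dx Dz Z X)
  (hZ' : forall x, Dx x -> derive1 Z x = Num.sqrt P.[x] / A.[x]) :
  let w := speed_density A P h in
  let Bx := boundary_conditions Dx h bl br in
  let Bz := transported_conditions A P h X Z Bx in
  let H1 := schrodinger (potential1 A P S X xi) in
  let H2 := schrodinger (potential2 A P S X Q theta xi) in
  (forall pL KH1 : R -> R -> R -> R,
     semigroup_kernel Dx w (generator A P h) Bx pL ->
     semigroup_kernel Dz (fun=> 1) (fun psi => \- H1 psi) Bz KH1 ->
     forall t T x y : R, t < T -> Dx x -> Dx y ->
       pL (T - t) x y =
       h y / h x * (A.[x] ^+ 2 / P.[x]) `^ (1 / 4)
       * (P.[y] / A.[y] ^+ 2) `^ (3 / 4) * KH1 (T - t) (Z x) (Z y)) /\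
  (forall pLt KH2 : R -> R -> R -> R,
     semigroup_kernel Dx w (feynman_kac A P h Q theta) Bx pLt ->
     semigroup_kernel Dz (fun=> 1) (fun psi => \- H2 psi) Bz KH2 ->
     forall t T x y : R, t < T -> Dx x -> Dx y ->
       pLt (T - t) x y =
       h y / h x * (A.[x] ^+ 2 / P.[x]) `^ (1 / 4)
       * (P.[y] / A.[y] ^+ 2) `^ (3 / 4) * KH2 (T - t) (Z x) (Z y)).
Proof.
move=> w Bx Bz H1 H2.
have P_gt0 x : Dx x -> 0 < P.[x].
  move=> Dxx; have := diffeomorphism_derive1_neq0 hDx_open hZ Dxx.
  rewrite hZ'// mulf_eq0 negb_or => /andP[sqrtP _].
  by rewrite lt_neqAle hP_ge0// andbT eq_sym; apply: contraNneq sqrtP => ->; rewrite sqrtr0.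
have EZ z : Dz z -> Dx (X z) by case: hZ => _ h2 _ _ /h2[].
split=> [pL KH1|pLt KH2] sL sH t T x y tT Dxx Dxy.
  apply: (kernel_relation (q := fun=> 0) hDx_open hDx_itv hP_ge0 hh_pos hh_C2 hh_ode hZ hZ'
    _ _ _ sL sH) => //.
  - by move=> u _; exact: cst_continuous.
  - by move=> f u _; rewrite mul0r subr0.
  - by move=> psi z _; rewrite /H1 /schrodinger addr0.
  - by rewrite subr_gt0.
apply: (kernel_relation (q := fun x => (Q theta).[x] / P.[x])
  hDx_open hDx_itv hP_ge0 hh_pos hh_C2 hh_ode hZ hZ' _ _ _ sL sH) => //.
- move=> u Du; apply: cvgM; first exact: continuous_horner.
  by apply: continuousV; [rewrite gt_eqF// P_gt0|exact: continuous_horner].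
- move=> f u Du; rewrite /feynman_kac /rate; congr (_ - _ * _).
  by field; rewrite htheta gt_eqF// P_gt0.
- move=> psi z Ez; rewrite /H2 /schrodinger /potential2 /potential1.
  by congr (- (_ + _ * _)); field; rewrite gt_eqF// P_gt0//; exact: EZ.
- by rewrite subr_gt0.
Qed.
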